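(* Let $\alpha,\beta\in[0,1)$ and $\delta\ge 0$, and let $f=h+\overline{g}\in\mathcal{S}_H^{\delta}[\alpha,\beta]$. Then the equation $$\begin{aligned}&2^{\delta-1}(2-\alpha)(1-\beta)+(1-\alpha)-2\left(2^{\delta-1}(2-\alpha)-(1-\alpha)\right)r\\&\quad-\left(2^{\delta-1}(2-\alpha)(3+\beta)+(1-\alpha)(3-\beta)\right)r^2-\left(2^{\delta}(2-\alpha)\beta+(1-\alpha)(4+2\beta)\right)r^3-3(1-\alpha)\beta r^4=0\end{aligned}$$ has exactly one root $r_0$ in the interval $(0,1)$, and the Bloch's constant $\mathcal{B}_f$ of $f$ satisfies $$\mathcal{B}_f\le \frac{1+\beta}{(2-\alpha)2^{\delta-1}}\cdot\frac{\left(1+r_0-r_0^2-r_0^3\right)\left((2-\alpha)2^{\delta-1}+(1-\alpha)r_0\right)}{1+\beta r_0}.$$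
   Context: $\mathbb{D}=\{z\in\mathbb{C}:|z|<1\}$. For $0\le\alpha<1$ and real $\delta$, $\mathcal{S}^{\delta}[\alpha]$ is the class of functions $h$ holomorphic in $\mathbb{D}$ of the form $h(z)=z+\sum_{n=2}^{\infty}a_nz^n$ (so $a_0=0$, $a_1=1$) with $\sum_{n=2}^{\infty}n^{\delta}\frac{n-\alpha}{1-\alpha}|a_n|\le 1$. $\mathcal{H}$ is the set of complex-valued harmonic functions $f=h+\overline{g}$ on $\mathbb{D}$, with $h(z)=\sum_{n\ge0}a_nz^n$ and $g(z)=\sum_{n\ge1}b_nz^n$ holomorphic in $\mathbb{D}$ (so $g(0)=0$), that are locally univalent and sense-preserving, i.e. $|g'(z)|<|h'(z)|$ for all $z\in\mathbb{D}$. For $\alpha,\beta\in[0,1)$ and real $\delta$, $\mathcal{S}_H^{\delta}[\alpha,\beta]$ is the set of $f=h+\overline{g}\in\mathcal{H}$ such that $h\in\mathcal{S}^{\delta}[\alpha]$ and $|b_1|=\beta$. The Bloch's constant of a harmonic function $f=h+\overline{g}$ on $\mathbb{D}$ is $$\mathcal{B}_f=\sup_{z,\xi\in\mathbb{D},\,z\ne\xi}\frac{|f(z)-f(\xi)|}{\mathcal{Q}(z,\xi)},\qquad \mathcal{Q}(z,\xi)=\operatorname{arctanh}\left|\frac{z-\xi}{1-\overline{z}\xi}\right|,$$ and by a known theorem of Colonna it equals $\sup_{z\in\mathbb{D}}(1-|z|^2)\left(|h'(z)|+|g'(z)|\right)$. *)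

(* Defs.v *)
From Stdlib Require Import Reals.
From Coquelicot Require Import Coquelicot.
Open Scope R_scope.

Definition unit_disk (z : C) : Prop := Cmod z < 1.

(* Complex differentiability at every point of the disk: the explicit
   [C_NormedModule] is the one over [C_AbsRing], not over the reals. *)
Definition holomorphic_on_disk (h : C -> C) : Prop :=
  forall z : C, unit_disk z -> @ex_derive C_AbsRing C_NormedModule h z.

Definition power_series_on_disk (a : nat -> C) (h : C -> C) : Prop :=
  forall z : C, unit_disk z -> @is_pseries C_AbsRing C_NormedModule a z (h z).

(* The weights are positive for [n >= 2], so [n ^ delta] is [Rpower]; the
   sum over [n >= 2] is reindexed as [n + 2].  [Series] is only meaningful
   together with convergence. *)
Definition class_S (delta alpha : R) (h : C -> C) : Prop :=
  holomorphic_on_disk h /\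
  exists a : nat -> C,
    power_series_on_disk a h /\ a 0%nat = RtoC 0 /\ a 1%nat = RtoC 1 /\
    let u := fun k : nat =>
      Rpower (INR (k + 2)) delta * ((INR (k + 2) - alpha) / (1 - alpha))
      * Cmod (a (k + 2)%nat) in
    ex_series u /\ Series u <= 1.

(* [f = h + conj g] is the canonical decomposition of a locally univalent
   sense-preserving harmonic map, with [a], [b] the coefficients of [h], [g];
   [b 0 = 0] is the normalisation [g(0) = 0].
   [C_derive] is the genuine complex derivative only where the function is
   holomorphic ([is_C_derive_unique]), which the first conjuncts provide. *)
Definition class_H (f h g : C -> C) (a b : nat -> C) : Prop :=
  holomorphic_on_disk h /\ holomorphic_on_disk g /\
  power_series_on_disk a h /\ power_series_on_disk b g /\
  b 0%nat = RtoC 0 /\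
  (forall z : C, unit_disk z -> f z = (h z + Cconj (g z))%C) /\
  (forall z : C, unit_disk z -> Cmod (C_derive g z) < Cmod (C_derive h z)).

Definition class_SH (delta alpha beta : R) (f : C -> C) : Prop :=
  exists (h g : C -> C) (a b : nat -> C),
    class_H f h g a b /\ class_S delta alpha h /\ Cmod (b 1%nat) = beta.

Definition arctanh (x : R) : R := / 2 * ln ((1 + x) / (1 - x)).

Definition hyp_dist (z xi : C) : R :=
  arctanh (Cmod ((z - xi) / (1 - Cconj z * xi))%C).

Definition Bloch_constant (f : C -> C) : Rbar :=
  Lub_Rbar (fun q : R => exists z xi : C,
    unit_disk z /\ unit_disk xi /\ z <> xi /\
    q = Cmod (f z - f xi)%C / hyp_dist z xi).

(* Main.v *)
Require Import Defs.
From Stdlib Require Import Reals Lra Psatz List ClassicalEpsilon.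
From Coquelicot Require Import Coquelicot.
Open Scope R_scope.

(** Write [r = |z|], [A = 1 - alpha], [M = 2^(delta-1) (2 - alpha)].  The bound
    on the Bloch constant comes from three estimates.

    - Growth of [h'].  Since [n <= (A/M) n^delta (n - alpha)/(1 - alpha)] for
      [n >= 2], with equality at [n = 2], the coefficient condition gives
      [|h'(z)| <= 1 + (A/M) r] ([class_S_derivative_bound]).
    - Dilatation.  The quotient [g'/h'] maps the disk into itself and has
      modulus [beta] at [0], so by Schwarz-Pick
      [|g'(z)| <= |h'(z)| (r + beta)/(1 + beta r)] ([schwarz_pick_dilatation]).
    - Colonna's formula, in the direction needed here.  If
      [(1 - |z|^2)(|h'(z)| + |g'(z)|) <= K] on the disk, then integrating along
      the hyperbolic geodesic from [z] to [xi] gives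
      [|f(z) - f(xi)| <= K hyp_dist z xi] ([Bloch_quotient_le]).

    Together they bound the Bloch constant by [(1 + beta)/M] times the maximum
    over [0 <= r < 1] of
    [(1 + r)^2 (1 - r)(M + A r)/(1 + beta r)].  The numerator of the derivative
    of this function is the quartic of the theorem, which is [1 + r] times a
    cubic that is decreasing on [r >= 0], positive at [0] and negative at [1].
    Hence there is a single root [r0], and the maximum is attained there.

    Schwarz-Pick needs a maximum principle for quotients of power series, and
    the geodesic argument needs derivatives of power series along curves.  Both
    are obtained from one local notion, the second-order jet ([has_jet]).
    Second order is what makes the maximum principle elementary: averaging
    [|c0 + c1 w + c2 w^2|^2] over the four points [w = s, i s, -s, -i s] gives at
    least [|c0|^2], while the same average of [eps |z0 + w|^2] exceeds
    [eps |z0|^2] by [eps s^2], which beats the error [O(s^3)] of the jets.  So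
    [|psi|^2 + eps |z|^2] has no local maximum in the disk. *)

(** * Complex series with coefficients on the unit disk *)

Notation is_Cseries := (@is_series C_AbsRing C_NormedModule).
Notation is_Cpseries := (@is_pseries C_AbsRing C_NormedModule).

Lemma Cmod_minus_sym (x y : C) : Cmod (x - y) = Cmod (y - x).
Proof. rewrite <- (Cmod_opp (x - y)). f_equal. ring. Qed.

Lemma Cmod_triangle_minus (x y : C) : Cmod (x - y) <= Cmod x + Cmod y.
Proof.
  replace (x - y)%C with (x + - y)%C by ring.
  rewrite <- (Cmod_opp y). apply Cmod_triangle.
Qed.

Lemma Cmod_le_add (x y : C) : Cmod x <= Cmod y + Cmod (x - y).
Proof.
  replace x with (y + (x - y))%C at 1 by ring. apply Cmod_triangle.
Qed.

Lemma is_Cseries_Cmod_le (a : nat -> C) (l : C) (b : nat -> R) :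
  is_Cseries a l -> (forall n, Cmod (a n) <= b n) -> ex_series b ->
  Cmod l <= Series b.
Proof.
  intros Ha Hle Hb.
  apply (is_lim_seq_le (fun n => Cmod (sum_n a n)) (sum_n b) (Cmod l) (Series b)).
  - intro n. eapply Rle_trans; [apply (norm_sum_n_m a 0 n)|].
    now apply sum_n_m_le.
  - exact (filterlim_comp _ _ _ _ _ _ _ _ Ha
             (@filterlim_norm C_AbsRing C_NormedModule l)).
  - now apply Series_correct.
Qed.

Lemma ex_Cseries_dominated (a : nat -> C) (b : nat -> R) :
  (forall n, Cmod (a n) <= b n) -> ex_series b -> exists l : C, is_Cseries a l.
Proof. exact (@ex_series_le C_AbsRing C_CompleteNormedModule a b). Qed.

(** [n a_n] are the coefficients of [x] times the derived series. *)
Lemma CV_radius_scal_INR (a : nat -> R) :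
  CV_radius (fun n => INR n * a n) = CV_radius a.
Proof.
  rewrite <- (CV_radius_derive a), <- (CV_radius_incr_1 (PS_derive a)).
  apply CV_radius_ext. intros [|n]; simpl; [apply Rmult_0_l|reflexivity].
Qed.

Lemma CV_radius_scal_INR_pow (a : nat -> R) (k : nat) :
  CV_radius (fun n => INR n ^ k * a n) = CV_radius a.
Proof.
  induction k as [|k IH].
  - apply CV_radius_ext. intro n. simpl. ring.
  - rewrite <- IH, <- (CV_radius_scal_INR (fun n => INR n ^ k * a n)).
    apply CV_radius_ext. intro n. simpl. ring.
Qed.

Lemma eventually_bounded (t : nat -> R) (N : nat) (B : R) :
  (forall n, (N <= n)%nat -> t n <= B) -> exists M, forall n, t n <= M.
Proof.
  revert B. induction N as [|N IH]; intros B H.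
  - exists B. intro n. apply H. lia.
  - apply (IH (Rmax B (t N))). intros n Hn.
    destruct (Nat.eq_dec n N) as [->|Hne]; [apply Rmax_r|].
    eapply Rle_trans; [apply H; lia|apply Rmax_l].
Qed.

(** The general term of a convergent series is bounded, and the radius of
    convergence is the supremum of the [r] for which [|a_n| r^n] is bounded.
    Passing to the moduli of the coefficients makes the theory of real power
    series available. *)
Lemma CV_radius_Cmod_ge (a : nat -> C) (r : R) (l : C) :
  0 <= r -> is_Cpseries a (RtoC r) l ->
  Rbar_le r (CV_radius (fun n => Cmod (a n))).
Proof.
  intros Hr Hs.
  apply (CV_radius_bounded (fun n => Cmod (a n))).
  destruct (Cauchy_ex_series (V := C_CompleteNormedModule) _
              (ex_intro _ l Hs) (mkposreal 1 Rlt_0_1)) as [N HN].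
  apply (eventually_bounded _ N 1). intros n Hn.
  specialize (HN n n Hn Hn). rewrite sum_n_n in HN.
  (* The Cauchy criterion with a one-term block bounds that term by 1. *)
  replace (Rabs (Cmod (a n) * r ^ n)) with (Cmod ((RtoC r) ^ n * a n)%C).
  - left. exact HN.
  - rewrite Cmod_mult, Cmod_pow, Cmod_R, (Rabs_pos_eq r Hr), Rabs_pos_eq.
    + ring.
    + apply Rmult_le_pos; [apply Cmod_ge_0|now apply pow_le].
Qed.

(** Multiplying coefficients by powers of [n] does not change the radius of
    convergence: this gives the summability of all Taylor remainders below. *)
Lemma power_series_moments (a : nat -> C) (h : C -> C) (k : nat) (r : R) :
  power_series_on_disk a h -> 0 <= r < 1 ->
  ex_series (fun n => INR n ^ k * Cmod (a n) * r ^ n).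
Proof.
  intros Ha Hr.
  apply ex_series_ext with (fun n => Rabs (INR n ^ k * Cmod (a n) * r ^ n)).
  { intro n. apply Rabs_pos_eq. repeat apply Rmult_le_pos; try apply Cmod_ge_0;
    apply pow_le; [apply pos_INR|lra]. }
  apply (CV_disk_inside (fun n => INR n ^ k * Cmod (a n))).
  rewrite CV_radius_scal_INR_pow, Rabs_pos_eq by lra.
  apply Rbar_lt_le_trans with ((r + 1) / 2); [simpl; lra|].
  apply CV_radius_Cmod_ge with (h (RtoC ((r + 1) / 2))); [lra|].
  apply Ha. unfold unit_disk. rewrite Cmod_R, Rabs_pos_eq; lra.
Qed.

(** * Power series have second-order jets *)

(** [taylor_pow z k n] is the coefficient of [w^k] in [(z + w)^n], that is
    [binomial n k * z^(n-k)]; Pascal's rule replaces the closed form, which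
    would need truncated subtraction. *)
Fixpoint taylor_pow (z : C) (k n : nat) : C :=
  match n with
  | O => match k with O => 1 | S _ => 0 end
  | S m => z * taylor_pow z k m
           + match k with O => 0 | S j => taylor_pow z j m end
  end%C.

Lemma taylor_pow_0 (z : C) (n : nat) : taylor_pow z 0 n = (z ^ n)%C.
Proof. induction n as [|n IH]; simpl; [reflexivity|rewrite IH; ring]. Qed.

Lemma taylor_pow_1_S (z : C) (n : nat) :
  taylor_pow z 1 (S n) = (RtoC (INR (S n)) * z ^ n)%C.
Proof.
  induction n as [|n IH].
  - simpl. ring.
  - change (taylor_pow z 1 (S (S n)))
      with (z * taylor_pow z 1 (S n) + taylor_pow z 0 (S n))%C.
    rewrite IH, taylor_pow_0, (S_INR (S n)), RtoC_plus. simpl (z ^ S n)%C. ring.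
Qed.

Lemma pow_S_ge_sum (x : R) (k : nat) : 0 <= x -> x ^ S k + x ^ k <= (x + 1) ^ S k.
Proof.
  intro Hx. replace (x ^ S k + x ^ k) with ((x + 1) * x ^ k) by (simpl; ring).
  simpl. apply Rmult_le_compat_l; [lra|]. apply pow_incr. lra.
Qed.

(** The division by [rho ^ k] keeps the full power [rho ^ n] in the numerator,
    so that the induction on [n] never meets a negative exponent. *)
Lemma Cmod_taylor_pow_le (z : C) (rho : R) (k n : nat) :
  0 < rho -> Cmod z <= rho ->
  Cmod (taylor_pow z k n) <= INR n ^ k * rho ^ n / rho ^ k.
Proof.
  intros Hrho Hz. revert k. induction n as [|n IH]; intro k.
  - destruct k; simpl.
    + rewrite Cmod_1. lra.
    + rewrite Cmod_0. right. field. split; [apply pow_nonzero|]; lra.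
  - simpl taylor_pow. rewrite S_INR. eapply Rle_trans; [apply Cmod_triangle|].
    rewrite Cmod_mult.
    assert (H1 : Cmod z * Cmod (taylor_pow z k n)
                 <= rho * (INR n ^ k * rho ^ n / rho ^ k)).
    { apply Rmult_le_compat; auto using Cmod_ge_0. }
    destruct k as [|j].
    + rewrite Cmod_0. simpl in *. lra.
    + specialize (IH j).
      apply Rle_trans with ((INR n ^ S j + INR n ^ j) * (rho ^ S n / rho ^ S j)).
      * eapply Rle_trans; [apply Rplus_le_compat; [apply H1|apply IH]|].
        right. simpl. field. split; [apply pow_nonzero|]; lra.
      * replace ((INR n + 1) ^ S j * rho ^ S n / rho ^ S j)
          with ((INR n + 1) ^ S j * (rho ^ S n / rho ^ S j)) by (unfold Rdiv; ring).
        apply Rmult_le_compat_r.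
        -- left. apply Rdiv_lt_0_compat; now apply pow_lt.
        -- apply pow_S_ge_sum, pos_INR.
Qed.

Definition pow_jet (z w : C) (n : nat) : C :=
  (taylor_pow z 0 n + taylor_pow z 1 n * w + taylor_pow z 2 n * w ^ 2)%C.

(** Going from [n] to [n + 1] multiplies the error by [z + w] and adds the one
    term of degree three, [taylor_pow z 2 n * w ^ 3]. *)
Lemma pow_jet_error (z w : C) (rho : R) (n : nat) :
  0 < rho -> Cmod z <= rho -> Cmod (z + w) <= rho ->
  Cmod ((z + w) ^ n - pow_jet z w n)
    <= INR n ^ 3 * rho ^ n / rho ^ 3 * Cmod w ^ 3.
Proof.
  intros Hrho Hz Hzw. induction n as [|n IH].
  - unfold pow_jet. simpl.
    replace (1 - (1 + 0 * w + 0 * (w * (w * 1))))%C with (RtoC 0) by ring.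
    rewrite Cmod_0. right. field. lra.
  - replace ((z + w) ^ S n - pow_jet z w (S n))%C
      with ((z + w) * ((z + w) ^ n - pow_jet z w n) + taylor_pow z 2 n * w ^ 3)%C
      by (unfold pow_jet; simpl; ring).
    eapply Rle_trans; [apply Cmod_triangle|]. rewrite !Cmod_mult, Cmod_pow.
    pose proof (Cmod_taylor_pow_le z rho 2 n Hrho Hz) as H2.
    pose proof (pow_le _ 3 (Cmod_ge_0 w)) as Hw.
    eapply Rle_trans.
    { apply Rplus_le_compat.
      - apply Rmult_le_compat; try apply Cmod_ge_0; [apply Hzw|apply IH].
      - apply Rmult_le_compat_r; [apply Hw|apply H2]. }
    replace (rho * (INR n ^ 3 * rho ^ n / rho ^ 3 * Cmod w ^ 3)
             + INR n ^ 2 * rho ^ n / rho ^ 2 * Cmod w ^ 3)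
      with ((INR n ^ 3 + INR n ^ 2) * (rho ^ S n / rho ^ 3 * Cmod w ^ 3))
      by (simpl; field; lra).
    replace (INR (S n) ^ 3 * rho ^ S n / rho ^ 3 * Cmod w ^ 3)
      with ((INR n + 1) ^ 3 * (rho ^ S n / rho ^ 3 * Cmod w ^ 3))
      by (rewrite S_INR; unfold Rdiv; ring).
    apply Rmult_le_compat_r.
    + apply Rmult_le_pos; [|apply Hw]. left.
      apply Rdiv_lt_0_compat; now apply pow_lt.
    + apply pow_S_ge_sum, pos_INR.
Qed.

(** An error of order three is asked for because the maximum principle compares
    the jet with a perturbation of size [|w|^2]. *)
Definition has_jet (f : C -> C) (z c0 c1 c2 : C) : Prop :=
  exists M d : R, 0 < d /\ forall w : C, Cmod w < d ->
    Cmod (f (z + w)%C - (c0 + c1 * w + c2 * w ^ 2)) <= M * Cmod w ^ 3.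

Definition derived_coeffs (a : nat -> C) (n : nat) : C :=
  (RtoC (INR (S n)) * a (S n))%C.

(** Termwise expansion: with [rho] strictly between [|z|] and [1], the
    remainders of the monomials are summable against the coefficients as soon as
    [z + w] stays in the disk of radius [rho].  The linear coefficient is
    recorded as the sum of the derived series, since it will be the complex
    derivative. *)
Lemma power_series_has_jet (a : nat -> C) (h : C -> C) (z : C) :
  power_series_on_disk a h -> unit_disk z ->
  exists c1 c2 : C,
    has_jet h z (h z) c1 c2 /\ is_Cpseries (derived_coeffs a) z c1.
Proof.
  intros Ha Hz. unfold unit_disk in Hz.
  pose proof (Cmod_ge_0 z) as Hz0.
  set (rho := (Cmod z + 1) / 2).
  assert (Hrho : 0 < rho < 1) by (unfold rho; lra).
  assert (Hsum : forall k, ex_series (fun n => INR n ^ k * Cmod (a n) * rho ^ n / rho ^ k)).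
  { intro k. apply ex_series_ext with
      (fun n => scal (/ rho ^ k) (INR n ^ k * Cmod (a n) * rho ^ n)).
    - intro n. unfold scal; simpl; unfold mult; simpl. unfold Rdiv. ring.
    - apply (@ex_series_scal R_AbsRing R_NormedModule).
      apply power_series_moments with h; [assumption|lra]. }
  assert (Hk : forall k, exists l : C, is_Cseries (fun n => taylor_pow z k n * a n)%C l).
  { intro k. apply ex_Cseries_dominated with (2 := Hsum k).
    intro n. rewrite Cmod_mult.
    replace (INR n ^ k * Cmod (a n) * rho ^ n / rho ^ k)
      with ((INR n ^ k * rho ^ n / rho ^ k) * Cmod (a n)) by (unfold Rdiv; ring).
    apply Rmult_le_compat_r; [apply Cmod_ge_0|].
    apply Cmod_taylor_pow_le; unfold rho; lra. }
  destruct (Hk 1%nat) as [c1 H1]. destruct (Hk 2%nat) as [c2 H2].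
  assert (H0 : is_Cseries (fun n => taylor_pow z 0 n * a n)%C (h z)).
  { apply is_series_ext with (2 := Ha z Hz). intro n. now rewrite taylor_pow_0. }
  exists c1, c2. split.
  - exists (Series (fun n => INR n ^ 3 * Cmod (a n) * rho ^ n / rho ^ 3)), ((1 - Cmod z) / 2).
    split; [lra|]. intros w Hw.
    assert (Hzw : Cmod (z + w) <= rho).
    { eapply Rle_trans; [apply Cmod_triangle|]. unfold rho; lra. }
    pose proof (is_series_minus _ _ _ _ (Ha (z + w)%C ltac:(unfold unit_disk; lra))
      (is_series_plus _ _ _ _ (is_series_plus _ _ _ _ H0 (is_series_scal w _ _ H1))
        (is_series_scal (w ^ 2)%C _ _ H2))) as HE.
    replace (h (z + w)%C - (h z + c1 * w + c2 * w ^ 2))%C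
      with (h (z + w)%C + - (h z + w * c1 + w ^ 2 * c2))%C by ring.
    rewrite <- Series_scal_r.
    apply (is_Cseries_Cmod_le _ _ _ HE).
    + intro n.
      match goal with |- Cmod ?x <= _ =>
        replace x with (((z + w) ^ n - pow_jet z w n) * a n)%C end.
      * rewrite Cmod_mult.
        replace (INR n ^ 3 * Cmod (a n) * rho ^ n / rho ^ 3 * Cmod w ^ 3)
          with ((INR n ^ 3 * rho ^ n / rho ^ 3 * Cmod w ^ 3) * Cmod (a n))
          by (unfold Rdiv; ring).
        apply Rmult_le_compat_r; [apply Cmod_ge_0|].
        apply pow_jet_error; unfold rho in *; lra.
      * unfold pow_jet.
        change (((z + w) ^ n - (taylor_pow z 0 n + taylor_pow z 1 n * w + taylor_pow z 2 n * w ^ 2)) * a n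
          = (z + w) ^ n * a n + - (taylor_pow z 0 n * a n + w * (taylor_pow z 1 n * a n)
              + w ^ 2 * (taylor_pow z 2 n * a n)))%C.
        ring.
    + apply ex_series_scal_r, Hsum.
  - assert (H1' : is_Cseries (fun n => taylor_pow z 1 (S n) * a (S n))%C c1).
    { apply (is_series_incr_1 (fun n => taylor_pow z 1 n * a n)%C).
      replace (plus c1 _) with c1; [exact H1|].
      change (@eq C c1 (c1 + 0 * a 0%nat)%C). ring. }
    apply is_series_ext with (2 := H1'). intro n. rewrite taylor_pow_1_S.
    change (@eq C (RtoC (INR (S n)) * z ^ n * a (S n))%C
                  (z ^ n * (RtoC (INR (S n)) * a (S n)))%C).
    ring.
Qed.

Lemma has_jet_small (f : C -> C) (z c0 c1 c2 : C) :
  has_jet f z c0 c1 c2 ->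
  exists M d : R, 0 <= M /\ 0 < d <= 1 /\ forall w : C, Cmod w < d ->
    Cmod (f (z + w)%C - (c0 + c1 * w + c2 * w ^ 2)) <= M * Cmod w ^ 3.
Proof.
  intros (M & d & Hd & H). exists (Rmax M 0), (Rmin d 1).
  split; [apply Rmax_r|]. split.
  { split; [apply Rmin_glb_lt; lra|apply Rmin_r]. }
  intros w Hw. eapply Rle_trans.
  - apply H. eapply Rlt_le_trans; [apply Hw|apply Rmin_l].
  - apply Rmult_le_compat_r; [apply pow_le, Cmod_ge_0|apply Rmax_l].
Qed.

Lemma has_jet_first_order (f : C -> C) (z c0 c1 c2 : C) :
  has_jet f z c0 c1 c2 ->
  exists M d : R, 0 <= M /\ 0 < d <= 1 /\ forall w : C, Cmod w < d ->
    Cmod (f (z + w)%C - (c0 + c1 * w)) <= M * Cmod w ^ 2.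
Proof.
  intros H. destruct (has_jet_small _ _ _ _ _ H) as (M & d & HM & Hd & Hj).
  exists (M + Cmod c2), d. pose proof (Cmod_ge_0 c2).
  split; [lra|]. split; [assumption|]. intros w Hw.
  pose proof (Cmod_ge_0 w).
  replace (f (z + w)%C - (c0 + c1 * w))%C
    with (f (z + w)%C - (c0 + c1 * w + c2 * w ^ 2) + c2 * w ^ 2)%C by ring.
  eapply Rle_trans; [apply Cmod_triangle|].
  rewrite Cmod_mult, Cmod_pow. specialize (Hj w Hw).
  assert (M * Cmod w ^ 3 <= M * Cmod w ^ 2); [|lra].
  apply Rmult_le_compat_l; [assumption|].
  replace (Cmod w ^ 3) with (Cmod w * Cmod w ^ 2) by ring.
  rewrite <- (Rmult_1_l (Cmod w ^ 2)) at 2.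
  apply Rmult_le_compat_r; [now apply pow_le|lra].
Qed.

Lemma has_jet_lipschitz (f : C -> C) (z c0 c1 c2 : C) :
  has_jet f z c0 c1 c2 ->
  exists L d : R, 0 <= L /\ 0 < d <= 1 /\ forall w : C, Cmod w < d ->
    Cmod (f (z + w)%C - c0) <= L * Cmod w.
Proof.
  intros H. destruct (has_jet_first_order _ _ _ _ _ H) as (M & d & HM & Hd & Hj).
  exists (M + Cmod c1), d. pose proof (Cmod_ge_0 c1).
  split; [lra|]. split; [assumption|]. intros w Hw.
  pose proof (Cmod_ge_0 w).
  replace (f (z + w)%C - c0)%C
    with (f (z + w)%C - (c0 + c1 * w) + c1 * w)%C by ring.
  eapply Rle_trans; [apply Cmod_triangle|].
  rewrite Cmod_mult. specialize (Hj w Hw).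
  assert (M * Cmod w ^ 2 <= M * Cmod w); [|lra].
  apply Rmult_le_compat_l; [assumption|]. simpl. nra.
Qed.

(** The coefficients of the quotient are those of the formal division of
    [u0 + u1 w + u2 w^2] by [v0 + v1 w + v2 w^2].  Multiplying back, the terms of
    degree at most two cancel, and [v] stays away from [0] near [z].  The linear
    coefficient is kept explicit to differentiate Moebius maps. *)
Lemma has_jet_div (u v : C -> C) (z u0 u1 u2 v0 v1 v2 : C) :
  has_jet u z u0 u1 u2 -> has_jet v z v0 v1 v2 -> v0 <> RtoC 0 ->
  exists c2 : C,
    has_jet (fun x => u x / v x)%C z (u0 / v0) ((u1 - u0 / v0 * v1) / v0) c2.
Proof.
  intros Hu Hv Hv0.
  destruct (has_jet_small _ _ _ _ _ Hu) as (Mu & du & HMu & Hdu & Ju).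
  destruct (has_jet_small _ _ _ _ _ Hv) as (Mv & dv & HMv & Hdv & Jv).
  destruct (has_jet_lipschitz _ _ _ _ _ Hv) as (L & dl & HL & Hdl & Lv).
  set (c0 := (u0 / v0)%C). set (c1 := ((u1 - c0 * v1) / v0)%C).
  set (c2 := ((u2 - c0 * v2 - c1 * v1) / v0)%C). exists c2.
  pose proof (proj1 (Cmod_gt_0 v0) Hv0) as Hm.
  set (m := Cmod v0) in *.
  set (P := Cmod c0 + Cmod c1 + Cmod c2).
  (* Terms of degree 3 and 4 of the jet of v times the jet of the quotient. *)
  set (e3 := (v1 * c2 + v2 * c1)%C). set (e4 := (v2 * c2)%C).
  exists ((Mu + Mv * P + Cmod e3 + Cmod e4) / (m / 2)),
    (Rmin (Rmin du dv) (Rmin dl (m / (2 * (L + 1))))).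
  split.
  { repeat apply Rmin_glb_lt; try lra. apply Rdiv_lt_0_compat; lra. }
  intros w Hw.
  assert (Hwu : Cmod w < du) by
    (eapply Rlt_le_trans; [apply Hw|eapply Rle_trans; [apply Rmin_l|apply Rmin_l]]).
  assert (Hwv : Cmod w < dv) by
    (eapply Rlt_le_trans; [apply Hw|eapply Rle_trans; [apply Rmin_l|apply Rmin_r]]).
  assert (Hwl : Cmod w < dl) by
    (eapply Rlt_le_trans; [apply Hw|eapply Rle_trans; [apply Rmin_r|apply Rmin_l]]).
  assert (Hwm : Cmod w < m / (2 * (L + 1))) by
    (eapply Rlt_le_trans; [apply Hw|eapply Rle_trans; [apply Rmin_r|apply Rmin_r]]).
  specialize (Ju w Hwu). specialize (Jv w Hwv). specialize (Lv w Hwl).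
  pose proof (Cmod_ge_0 w) as Hw0.
  assert (Hvw : m / 2 <= Cmod (v (z + w)%C)).
  { pose proof (Cmod_le_add v0 (v (z + w)%C)) as Ht.
    rewrite Cmod_minus_sym in Ht. fold m in Ht.
    assert (L * Cmod w <= m / 2); [|lra].
    apply (Rmult_lt_compat_r (2 * (L + 1))) in Hwm; [|lra].
    replace (m / (2 * (L + 1)) * (2 * (L + 1))) with m in Hwm by (field; lra).
    nra. }
  assert (Hne : v (z + w)%C <> RtoC 0).
  { intro E. rewrite E, Cmod_0 in Hvw. lra. }
  set (p := (c0 + c1 * w + c2 * w ^ 2)%C).
  replace (u (z + w)%C / v (z + w)%C - p)%C
    with ((u (z + w)%C - v (z + w)%C * p) / v (z + w)%C)%C by (field; assumption).
  rewrite Cmod_div by assumption.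
  assert (Hp : Cmod p <= P).
  { unfold p, P. eapply Rle_trans; [apply Cmod_triangle|].
    apply Rplus_le_compat; [eapply Rle_trans; [apply Cmod_triangle|];
      apply Rplus_le_compat_l|]; rewrite Cmod_mult;
      rewrite <- (Rmult_1_r (Cmod _)) at 2; apply Rmult_le_compat_l;
      try apply Cmod_ge_0; [lra|].
    rewrite Cmod_pow. simpl. nra. }
  assert (Hnum : Cmod (u (z + w)%C - v (z + w)%C * p)
                 <= (Mu + Mv * P + Cmod e3 + Cmod e4) * Cmod w ^ 3).
  { replace (u (z + w)%C - v (z + w)%C * p)%C
      with ((u (z + w)%C - (u0 + u1 * w + u2 * w ^ 2))
            - (v (z + w)%C - (v0 + v1 * w + v2 * w ^ 2)) * p
            - (e3 * w ^ 3 + e4 * (w * w ^ 3)))%C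
      by (unfold p, e3, e4, c2, c1, c0; field; assumption).
    eapply Rle_trans; [apply Cmod_triangle_minus|].
    eapply Rle_trans; [apply Rplus_le_compat_r, Cmod_triangle_minus|].
    eapply Rle_trans; [apply Rplus_le_compat_l, Cmod_triangle|].
    rewrite !Cmod_mult, !Cmod_pow.
    pose proof (pow_le _ 3 Hw0) as Hw3.
    assert (Cmod (v (z + w)%C - (v0 + v1 * w + v2 * w ^ 2)) * Cmod p
            <= Mv * Cmod w ^ 3 * P)
      by (apply Rmult_le_compat; auto using Cmod_ge_0).
    assert (Cmod e4 * (Cmod w * Cmod w ^ 3) <= Cmod e4 * Cmod w ^ 3).
    { apply Rmult_le_compat_l; [apply Cmod_ge_0|]. nra. }
    lra. }
  unfold Rdiv.
  apply Rle_trans with ((Mu + Mv * P + Cmod e3 + Cmod e4) * Cmod w ^ 3 * / (m / 2)).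
  - apply Rmult_le_compat; auto using Cmod_ge_0.
    + left. apply Rinv_0_lt_compat. lra.
    + apply Rinv_le_contravar; lra.
  - right. unfold Rdiv. ring.
Qed.

Lemma has_jet_C_derive (f : C -> C) (z c1 c2 : C) :
  has_jet f z (f z) c1 c2 -> C_derive f z = c1.
Proof.
  intro H. apply is_C_derive_unique.
  destruct (has_jet_first_order _ _ _ _ _ H) as (M & d & HM & Hd & Hj).
  split; [apply (@is_linear_scal_l C_AbsRing C_NormedModule)|].
  intros x Hx.
  pose proof (@is_filter_lim_locally_unique C_AbsRing (AbsRing_NormedModule C_AbsRing) _ _ Hx) as <-.
  clear Hx. intros [eps Heps].
  assert (Hdd : 0 < Rmin d (eps / (M + 1))).
  { apply Rmin_glb_lt; [lra|]. apply Rdiv_lt_0_compat; lra. }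
  exists (mkposreal _ Hdd).
  change (forall y : C, Cmod (y - z) < Rmin d (eps / (M + 1)) ->
            Cmod ((f y - f z) - (y - z) * c1) <= eps * Cmod (y - z)).
  intros y Hy.
  specialize (Hj (y - z)%C (Rlt_le_trans _ _ _ Hy (Rmin_l _ _))).
  replace (z + (y - z))%C with y in Hj by ring.
  replace (f y - f z - (y - z) * c1)%C with (f y - (f z + c1 * (y - z)))%C by ring.
  eapply Rle_trans; [apply Hj|].
  pose proof (Cmod_ge_0 (y - z)).
  assert (Cmod (y - z) < eps / (M + 1)) as Hs by
    (eapply Rlt_le_trans; [apply Hy|apply Rmin_r]).
  apply (Rmult_lt_compat_r (M + 1)) in Hs; [|lra].
  replace (eps / (M + 1) * (M + 1)) with eps in Hs by (field; lra).
  simpl. nra.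
Qed.

(** * The maximum principle *)

Lemma list_max_exists {T : Type} (S : C -> R) (K : C -> Prop) (p : T -> C)
    (x0 : C) (l : list T) :
  K x0 -> (forall t, K (p t)) ->
  exists x, K x /\ forall t, In t l -> S (p t) <= S x.
Proof.
  intros Hx0 Hp. induction l as [|t l IH].
  - exists x0. split; [assumption|]. intros t [].
  - destruct IH as (x & Hx & H).
    destruct (Rle_dec (S (p t)) (S x)) as [Hle|Hgt].
    + exists x. split; [assumption|]. intros t' [<-|Ht']; auto.
    + exists (p t). split; [apply Hp|]. intros t' [<-|Ht']; [lra|].
      specialize (H t' Ht'). lra.
Qed.

Lemma Cmod_le_Re_Im (z : C) : Cmod z <= Rabs (Re z) + Rabs (Im z).
Proof.
  replace z with (RtoC (Re z) + Ci * RtoC (Im z))%C at 1.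
  - eapply Rle_trans; [apply Cmod_triangle|].
    rewrite Cmod_mult, Cmod_Ci, !Cmod_R. lra.
  - destruct z as [x y]. unfold Cplus, Cmult, Ci, RtoC; simpl. f_equal; ring.
Qed.

Lemma im_le_Cmod (z : C) : Rabs (Im z) <= Cmod z.
Proof. eapply Rle_trans; [apply Rmax_r|apply (Rmax_Cmod z)]. Qed.

(** An upper semicontinuous function attains its maximum on a closed disk.  If
    not, every point has a neighbourhood on which [S] stays below some other
    value [S q] taken on the disk; for a finite subcover, the largest of these
    values is exceeded nowhere, yet it is taken at a point which lies in one of
    the neighbourhoods. *)
Lemma max_on_closed_disk (S : C -> R) (rho : R) :
  0 <= rho ->
  (forall z, Cmod z <= rho -> forall eta, 0 < eta -> exists d, 0 < d /\
     forall w, Cmod (w - z) < d -> S w < S z + eta) ->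
  exists z0, Cmod z0 <= rho /\ forall z, Cmod z <= rho -> S z <= S z0.
Proof.
  intros Hrho Husc. apply NNPP. intro Hno.
  set (K := fun z : C => Cmod z <= rho).
  assert (H0 : K (RtoC 0)) by (unfold K; rewrite Cmod_0; exact Hrho).
  assert (Hcover : forall z : C, exists q : posreal * C, K (snd q) /\
    forall w, K w -> Rabs (Re w - Re z) < fst q -> Rabs (Im w - Im z) < fst q ->
      S w < S (snd q)).
  { intro z.
    assert (Hsum : forall (w : C) d, Rabs (Re w - Re z) < d / 2 ->
       Rabs (Im w - Im z) < d / 2 -> Cmod (w - z) < d).
    { intros w d H1 H2. pose proof (Cmod_le_Re_Im (w - z)) as H3.
      unfold Cminus in H3. rewrite re_plus, re_opp, im_plus, im_opp in H3.
      unfold Rminus in *. unfold Cminus. lra. }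
    destruct (Rle_dec (Cmod z) rho) as [Hz|Hz].
    - assert (Hbig : exists p, K p /\ S z < S p).
      { apply NNPP. intro Hn. apply Hno. exists z. split; [exact Hz|].
        intros p Hp. apply Rnot_lt_le. intro Hlt. apply Hn. now exists p. }
      destruct Hbig as (p & Hp & Hlt).
      destruct (Husc z Hz (S p - S z)) as (d & Hd & Hloc); [lra|].
      assert (Hd2 : 0 < d / 2) by lra.
      exists (mkposreal _ Hd2, p). split; [exact Hp|]. simpl.
      intros w _ H1 H2. specialize (Hloc w (Hsum w d H1 H2)). lra.
    - (* The compactness lemma covers the square around the disk, so points
         outside the disk get a neighbourhood disjoint from it. *)
      assert (Hd2 : 0 < (Cmod z - rho) / 2) by lra.
      exists (mkposreal _ Hd2, RtoC 0). split; [exact H0|]. simpl.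
      intros w Hw H1 H2. exfalso. specialize (Hsum w _ H1 H2).
      pose proof (Cmod_le_add z w) as Ht. rewrite Cmod_minus_sym in Ht.
      unfold K in Hw. lra. }
  set (q := fun z => proj1_sig (constructive_indefinite_description _ (Hcover z))).
  assert (Hq : forall z, K (snd (q z)) /\
    forall w, K w -> Rabs (Re w - Re z) < fst (q z) -> Rabs (Im w - Im z) < fst (q z) ->
      S w < S (snd (q z))).
  { intro z. apply (proj2_sig (constructive_indefinite_description _ (Hcover z))). }
  set (pt := fun t : Compactness.Tn 2 R => (fst t, fst (snd t)) : C).
  apply (compactness_list 2 (- rho, (- rho, tt)) (rho, (rho, tt))
           (fun t => fst (q (pt t)))).
  intros (l & Hl).
  destruct (list_max_exists S K (fun t => snd (q (pt t))) (RtoC 0) l H0) as (x & Hx & Hmax).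
  { intro t. apply Hq. }
  pose proof (re_le_Cmod x) as Hre. pose proof (im_le_Cmod x) as Him.
  unfold K in Hx.
  destruct (Hl (Re x, (Im x, tt))) as (t & Ht & _ & Hclose).
  { pose proof (proj1 (Rabs_le_between _ _) (Rle_trans _ _ _ Hre Hx)).
    pose proof (proj1 (Rabs_le_between _ _) (Rle_trans _ _ _ Him Hx)).
    now repeat split. }
  destruct t as (t1 & t2 & []). simpl in Hclose. destruct Hclose as (Hc1 & Hc2 & _).
  specialize (Hmax _ Ht).
  exact (Rlt_not_le _ _ (proj2 (Hq (pt (t1, (t2, tt)))) x Hx Hc1 Hc2) Hmax).
Qed.

(** Parseval over the fourth roots of unity: the three frequencies 0, 1, 2 are
    distinct modulo 4, so the cross terms cancel. *)
Lemma quadratic_mean_fourth_roots (c0 c1 c2 : C) (s : R) :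
  let P := fun w : C => Cmod (c0 + c1 * w + c2 * w ^ 2)%C ^ 2 in
  P (RtoC s) + P (Ci * s)%C + P (- s)%C + P (- (Ci * s))%C
  = 4 * (Cmod c0 ^ 2 + Cmod c1 ^ 2 * s ^ 2 + Cmod c2 ^ 2 * s ^ 4).
Proof.
  cbv zeta. rewrite !Cmod2_alt.
  destruct c0 as [a0 b0], c1 as [a1 b1], c2 as [a2 b2].
  unfold Cplus, Cmult, Copp, Ci, RtoC, Re, Im; simpl. ring.
Qed.

Lemma Cmod_sqr_perturb (x y : C) (B e : R) :
  Cmod y <= B -> Cmod (x - y) <= e -> Cmod y ^ 2 - 2 * B * e <= Cmod x ^ 2.
Proof.
  intros Hy He.
  pose proof (Cmod_le_add y x) as Ht. rewrite Cmod_minus_sym in Ht.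
  pose proof (Cmod_ge_0 x). pose proof (Cmod_ge_0 y). pose proof (Cmod_ge_0 (x - y)).
  assert (Cmod y * Cmod (x - y) <= B * e) by (apply Rmult_le_compat; lra).
  destruct (Rle_dec (Cmod y) (Cmod (x - y))) as [Hle|Hgt].
  - assert (Cmod y ^ 2 <= Cmod y * Cmod (x - y)) by (simpl; nra).
    pose proof (pow2_ge_0 (Cmod x)).
    nra.
  - assert ((Cmod y - Cmod (x - y)) ^ 2 <= Cmod x ^ 2) by (apply pow_incr; lra).
    simpl in *; nra.
Qed.

(** The perturbation [eps |z|^2] makes the mean over a small square of points
    strictly larger than the value at its centre, whatever the jet is; without it
    a constant function would be an exception. *)
Lemma jet_no_local_max (psi : C -> C) (z c1 c2 : C) (eps d : R) :
  has_jet psi z (psi z) c1 c2 -> 0 < eps -> 0 < d ->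
  exists w : C, Cmod w < d /\
    Cmod (psi z) ^ 2 + eps * Cmod z ^ 2
    < Cmod (psi (z + w)%C) ^ 2 + eps * Cmod (z + w) ^ 2.
Proof.
  intros Hj Heps Hd.
  destruct (has_jet_small _ _ _ _ _ Hj) as (M & dj & HM & Hdj & J).
  set (B := Cmod (psi z) + Cmod c1 + Cmod c2).
  assert (HB : 0 <= B).
  { pose proof (Cmod_ge_0 (psi z)). pose proof (Cmod_ge_0 c1).
    pose proof (Cmod_ge_0 c2). unfold B; lra. }
  (* The last bound makes the cubic error 2 B M s^3 smaller than eps s^2. *)
  set (s := Rmin (Rmin dj d) (eps / (2 * B * M + 1)) / 2).
  assert (HBM : 0 <= 2 * B * M) by (apply Rmult_le_pos; lra).
  assert (Hs : 0 < s /\ s < dj /\ s < d /\ s * (2 * B * M) < eps).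
  { assert (0 < Rmin (Rmin dj d) (eps / (2 * B * M + 1))).
    { repeat apply Rmin_glb_lt; try lra. apply Rdiv_lt_0_compat; lra. }
    pose proof (Rmin_l (Rmin dj d) (eps / (2 * B * M + 1))).
    pose proof (Rmin_r (Rmin dj d) (eps / (2 * B * M + 1))) as Hr.
    pose proof (Rmin_l dj d). pose proof (Rmin_r dj d).
    repeat split; try (unfold s; lra).
    assert (s < eps / (2 * B * M + 1)) as H3 by (unfold s; lra).
    apply (Rmult_lt_compat_r (2 * B * M + 1)) in H3; [|lra].
    replace (eps / (2 * B * M + 1) * (2 * B * M + 1)) with eps in H3 by (field; lra).
    assert (0 < s) by (unfold s; lra). nra. }
  destruct Hs as (Hs0 & Hsj & Hsd & Hse).
  assert (Hpt : forall w : C, Cmod w = s ->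
    Cmod (psi z + c1 * w + c2 * w ^ 2) ^ 2 - 2 * B * (M * s ^ 3)
    <= Cmod (psi (z + w)%C) ^ 2).
  { intros w Hw. apply Cmod_sqr_perturb.
    - unfold B. eapply Rle_trans; [apply Cmod_triangle|].
      apply Rplus_le_compat; [eapply Rle_trans; [apply Cmod_triangle|];
        apply Rplus_le_compat_l|]; rewrite Cmod_mult;
        rewrite <- (Rmult_1_r (Cmod _)) at 2; apply Rmult_le_compat_l;
        try apply Cmod_ge_0; [lra|].
      rewrite Cmod_pow, Hw. simpl. nra.
    - rewrite <- Hw. apply J. lra. }
  apply NNPP. intro Hno.
  assert (Hmax : forall w : C, Cmod w = s ->
    Cmod (psi (z + w)%C) ^ 2 + eps * Cmod (z + w) ^ 2
    <= Cmod (psi z) ^ 2 + eps * Cmod z ^ 2).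
  { intros w Hw. apply Rnot_lt_le. intro Hlt. apply Hno. exists w.
    split; [lra|exact Hlt]. }
  assert (N1 : Cmod (RtoC s) = s) by (rewrite Cmod_R; apply Rabs_pos_eq; lra).
  assert (N2 : Cmod (Ci * s) = s) by (rewrite Cmod_mult, Cmod_Ci, N1; ring).
  assert (N3 : Cmod (- s) = s) by (rewrite Cmod_opp; exact N1).
  assert (N4 : Cmod (- (Ci * s)) = s) by (rewrite Cmod_opp; exact N2).
  pose proof (quadratic_mean_fourth_roots (psi z) c1 c2 s) as Q. cbv zeta in Q.
  pose proof (quadratic_mean_fourth_roots z 1 0 s) as Q'. cbv zeta in Q'.
  rewrite Cmod_1, Cmod_0 in Q'.
  assert (Hlin : forall w : C, (z + 1 * w + 0 * w ^ 2)%C = (z + w)%C) by (intro; ring).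
  rewrite !Hlin in Q'.
  pose proof (Hpt _ N1). pose proof (Hpt _ N2). pose proof (Hpt _ N3).
  pose proof (Hpt _ N4). pose proof (Hmax _ N1). pose proof (Hmax _ N2).
  pose proof (Hmax _ N3). pose proof (Hmax _ N4).
  assert (0 <= Cmod c1 ^ 2 * s ^ 2) by (apply Rmult_le_pos; apply pow2_ge_0).
  assert (0 <= Cmod c2 ^ 2 * s ^ 4).
  { apply Rmult_le_pos; [apply pow2_ge_0|apply pow_le; lra]. }
  assert (2 * B * (M * s ^ 3) < eps * s ^ 2).
  { replace (2 * B * (M * s ^ 3)) with (s * (2 * B * M) * s ^ 2) by ring.
    apply Rmult_lt_compat_r; [apply pow_lt; lra|assumption]. }
  nra.
Qed.

(** The Schwarz lemma for [z psi z].  If [|psi z1| = m > 1], take a radius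
    [rho < 1] so close to [1] that [|psi| <= m' < m] on the circle of radius
    [rho], and [eps] so small that [|psi|^2 + eps |z|^2] is still larger at [z1]
    than on this circle: its maximum on the closed disk is then interior. *)
Lemma schwarz_lemma_jets (psi : C -> C) :
  (forall z, unit_disk z -> exists c1 c2, has_jet psi z (psi z) c1 c2) ->
  (forall z, unit_disk z -> Cmod z * Cmod (psi z) <= 1) ->
  forall z, unit_disk z -> Cmod (psi z) <= 1.
Proof.
  unfold unit_disk. intros Hjet Hbd z1 Hz1. apply Rnot_lt_le. intro Hm.
  set (m := Cmod (psi z1)) in *. set (m' := (1 + m) / 2).
  assert (Hm' : 1 < m' < m) by (unfold m'; lra).
  set (eps := (m ^ 2 - m' ^ 2) / 2).
  assert (Heps : 0 < eps) by (unfold eps; simpl; nra).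
  set (rho := Rmax ((1 + Cmod z1) / 2) (/ m')).
  pose proof (Cmod_ge_0 z1).
  assert (Hinv : / m' < 1).
  { rewrite <- Rinv_1. apply Rinv_lt_contravar; lra. }
  assert (Hrho : Cmod z1 < rho < 1 /\ / m' <= rho).
  { repeat split.
    - eapply Rlt_le_trans; [|apply Rmax_l]. lra.
    - apply Rmax_lub_lt; lra.
    - apply Rmax_r. }
  destruct Hrho as [Hrho Hrm].
  set (S := fun z => Cmod (psi z) ^ 2 + eps * Cmod z ^ 2).
  destruct (max_on_closed_disk S rho) as (z0 & Hz0 & Hmax).
  - lra.
  - intros z Hz eta Heta. destruct (Hjet z) as (c1 & c2 & Hj); [lra|].
    destruct (has_jet_lipschitz _ _ _ _ _ Hj) as (L & d & HL & Hd & Lip).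
    set (A := (2 * Cmod (psi z) + L) * L + eps * (2 * Cmod z + 1)).
    pose proof (Cmod_ge_0 (psi z)). pose proof (Cmod_ge_0 z).
    assert (HA : 0 <= A).
    { unfold A. apply Rplus_le_le_0_compat; apply Rmult_le_pos; lra. }
    assert (Hq : 0 < eta / (A + 1)) by (apply Rdiv_lt_0_compat; lra).
    exists (Rmin d (eta / (A + 1))). split; [apply Rmin_glb_lt; lra|].
    intros w Hw.
    assert (Hw1 : Cmod (w - z) < d) by (eapply Rlt_le_trans; [apply Hw|apply Rmin_l]).
    assert (Hw2 : Cmod (w - z) < eta / (A + 1)) by
      (eapply Rlt_le_trans; [apply Hw|apply Rmin_r]).
    specialize (Lip _ Hw1). replace (z + (w - z))%C with w in Lip by ring.
    pose proof (Cmod_le_add (psi w) (psi z)) as T1.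
    pose proof (Cmod_le_add w z) as T2.
    set (t := Cmod (w - z)) in *.
    assert (Ht : 0 <= t) by apply Cmod_ge_0.
    apply (Rmult_lt_compat_r (A + 1)) in Hw2; [|lra].
    replace (eta / (A + 1) * (A + 1)) with eta in Hw2 by (field; lra).
    assert (P1 : Cmod (psi w) ^ 2 <= (Cmod (psi z) + L * t) ^ 2).
    { apply pow_incr. split; [apply Cmod_ge_0|lra]. }
    assert (P2 : Cmod w ^ 2 <= (Cmod z + t) ^ 2).
    { apply pow_incr. split; [apply Cmod_ge_0|lra]. }
    assert (P3 : eps * Cmod w ^ 2 <= eps * (Cmod z + t) ^ 2)
      by (apply Rmult_le_compat_l; lra).
    assert (t * t <= t) by nra.
    assert (L * L * (t * t) <= L * L * t) by (apply Rmult_le_compat_l; nra).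
    assert (eps * (t * t) <= eps * t) by (apply Rmult_le_compat_l; lra).
    unfold S. unfold A in Hw2. simpl in *. nra.
  - destruct (Rle_lt_or_eq_dec _ _ Hz0) as [Hin|Hbdry].
    + destruct (Hjet z0) as (c1 & c2 & Hj); [lra|].
      destruct (jet_no_local_max psi z0 c1 c2 eps (rho - Cmod z0) Hj Heps) as (w & Hw & Hgt);
        [lra|].
      assert (Hzw : Cmod (z0 + w) <= rho).
      { eapply Rle_trans; [apply Cmod_triangle|lra]. }
      specialize (Hmax _ Hzw). unfold S in Hmax. lra.
    + assert (Hsmall : Cmod (psi z0) <= m').
      { specialize (Hbd z0). rewrite Hbdry in Hbd.
        pose proof (Cmod_ge_0 (psi z0)).
        assert (/ m' * Cmod (psi z0) <= 1).
        { eapply Rle_trans; [|apply Hbd; lra]. now apply Rmult_le_compat_r. }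
        apply Rmult_le_reg_l with (/ m'); [apply Rinv_0_lt_compat; lra|].
        rewrite Rinv_l; lra. }
      assert (Hle : S z1 <= S z0) by (apply Hmax; lra).
      assert (Cmod (psi z0) ^ 2 <= m' ^ 2) by
        (apply pow_incr; split; [apply Cmod_ge_0|assumption]).
      assert (Cmod z0 ^ 2 <= 1).
      { rewrite <- (pow1 2). apply pow_incr; split; [apply Cmod_ge_0|lra]. }
      pose proof (pow2_ge_0 (Cmod z1)).
      unfold S in Hle. fold m in Hle. unfold eps in *. nra.
Qed.

(** * The Schwarz-Pick estimate for the dilatation *)

Lemma pseries_at_0 (a : nat -> C) (f : C -> C) :
  power_series_on_disk a f -> f (RtoC 0) = a 0%nat.
Proof.
  intro H. apply (@filterlim_locally_unique nat C_AbsRing C_NormedModule eventually _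
                    (sum_n (fun n => scal (pow_n (RtoC 0 : C_AbsRing) n) (a n : C_NormedModule)))).
  - apply H. unfold unit_disk. rewrite Cmod_0. lra.
  - apply (@is_pseries_0 C_AbsRing C_NormedModule).
Qed.

Lemma pseries_div_z (a : nat -> C) (f : C -> C) :
  power_series_on_disk a f -> a 0%nat = RtoC 0 ->
  power_series_on_disk (fun n => a (S n))
    (fun z => if Ceq_dec z 0 then a 1%nat else (f z / z)%C).
Proof.
  intros Hf Ha0 z Hz. destruct (Ceq_dec z 0) as [->|Hz0].
  - apply (@is_pseries_0 C_AbsRing C_NormedModule (fun n => a (S n))).
  - assert (Hinv : @mult C_AbsRing (/ z)%C z = one) by
      (change (@eq C (/ z * z)%C 1); field; exact Hz0).
    pose proof (is_pseries_decr_1 _ _ _ _ Hinv (Hf z Hz)) as H.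
    replace (f z / z)%C with (/ z * (f z + - a 0%nat))%C; [exact H|].
    rewrite Ha0. field. exact Hz0.
Qed.

Lemma pseries_lin_comb (a b : nat -> C) (f g : C -> C) (c : C) :
  power_series_on_disk a f -> power_series_on_disk b g ->
  power_series_on_disk (fun n => a n - c * b n)%C (fun z => f z - c * g z)%C.
Proof.
  intros Hf Hg z Hz.
  assert (Hc : @mult C_AbsRing z c = mult c z) by
    (change (@eq C (z * c)%C (c * z)%C); ring).
  exact (is_pseries_minus _ _ _ _ _ (Hf z Hz) (is_pseries_scal _ _ _ _ Hc (Hg z Hz))).
Qed.

Lemma Cmod_disk_automorphism (c p q : C) :
  Cmod (p - Cconj c * q) ^ 2 - Cmod (q - c * p) ^ 2
  = (1 - Cmod c ^ 2) * (Cmod p ^ 2 - Cmod q ^ 2).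
Proof.
  rewrite !Cmod2_alt. destruct c, p, q.
  unfold Cminus, Cplus, Cmult, Copp, Cconj, Re, Im; simpl. ring.
Qed.

(** Homogeneous form of: [|(w - c)/(1 - conj c w)| <= r] implies
    [|w| <= (r + |c|)/(1 + |c| r)], with [w = q/p].  After squaring, the
    hypothesis becomes a quadratic inequality between [|q|] and [|p|] that
    factors; the second factor cannot be the nonpositive one when the first is
    positive. *)
Lemma disk_automorphism_bound (c p q : C) (r : R) :
  Cmod c < 1 -> 0 <= r < 1 ->
  Cmod (q - c * p) <= r * Cmod (p - Cconj c * q) ->
  Cmod q * (1 + Cmod c * r) <= Cmod p * (r + Cmod c).
Proof.
  intros Hc Hr Hle.
  set (T := Re (q * Cconj (c * p))%C).
  assert (HT : T <= Cmod c * (Cmod p * Cmod q)).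
  { unfold T. eapply Rle_trans; [apply Rle_abs|].
    eapply Rle_trans; [apply re_le_Cmod|].
    rewrite Cmod_mult, Cmod_conj, Cmod_mult. lra. }
  assert (E1 : Cmod (q - c * p) ^ 2
               = Cmod q ^ 2 + Cmod c ^ 2 * Cmod p ^ 2 - 2 * T).
  { unfold T. rewrite !Cmod2_alt. destruct c, p, q.
    unfold Cminus, Cplus, Cmult, Copp, Cconj, Re, Im; simpl. ring. }
  pose proof (Cmod_disk_automorphism c p q) as E2.
  assert (Hsq : Cmod (q - c * p) ^ 2 <= r ^ 2 * Cmod (p - Cconj c * q) ^ 2).
  { rewrite <- Rpow_mult_distr. apply pow_incr. split; [apply Cmod_ge_0|exact Hle]. }
  pose proof (Cmod_ge_0 c). pose proof (Cmod_ge_0 p). pose proof (Cmod_ge_0 q).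
  set (x := Cmod q) in *. set (y := Cmod p) in *. set (b := Cmod c) in *.
  assert (Hr2 : 0 <= 1 - r ^ 2) by (simpl; nra).
  assert (HT2 : (1 - r ^ 2) * T <= (1 - r ^ 2) * (b * (y * x)))
    by (apply Rmult_le_compat_l; assumption).
  assert (Hfac : ((1 + b * r) * x - (r + b) * y) * ((1 - b * r) * x + (r - b) * y) <= 0).
  { replace (((1 + b * r) * x - (r + b) * y) * ((1 - b * r) * x + (r - b) * y))
      with ((x ^ 2 + b ^ 2 * y ^ 2) - r ^ 2 * (y ^ 2 + b ^ 2 * x ^ 2)
            - 2 * ((1 - r ^ 2) * (b * (y * x)))) by ring.
    nra. }
  apply Rnot_lt_le. intro Hlt.
  assert (K1 : 0 < (1 + b * r) * x - (r + b) * y) by lra.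
  assert (K2 : (1 - b * r) * x + (r - b) * y <= 0) by nra.
  assert (Hbr : 0 <= b * r < 1) by (split; nra).
  assert (K3 : (1 - b * r) * ((r + b) * y) < (1 - b * r) * ((1 + b * r) * x))
    by (apply Rmult_lt_compat_l; lra).
  assert (K4 : (1 + b * r) * ((1 - b * r) * x + (r - b) * y) <= 0) by nra.
  assert (0 <= r * (1 - b * b) * y) by (repeat apply Rmult_le_pos; nra).
  nra.
Qed.

(** The Moebius map sending [c = q(0)/p(0)] to [0] turns [q/p] into [u/v], with
    [u] and [v] linear combinations of [p] and [q].  The series of [u] has no
    constant term, so [u = z w] with [w] a power series and the Schwarz lemma
    applies to [w/v]; staying with quotients of power series avoids expanding
    [q/p] itself. *)
Lemma schwarz_pick_dilatation (a b : nat -> C) (p q : C -> C) :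
  power_series_on_disk a p -> power_series_on_disk b q -> a 0%nat = RtoC 1 ->
  (forall z, unit_disk z -> Cmod (q z) < Cmod (p z)) ->
  forall z, unit_disk z ->
    Cmod (q z) * (1 + Cmod (b 0%nat) * Cmod z)
    <= Cmod (p z) * (Cmod z + Cmod (b 0%nat)).
Proof.
  intros Hp Hq Ha0 Hlt z Hz.
  set (c := b 0%nat).
  assert (Hc : Cmod c < 1).
  { unfold c. rewrite <- Cmod_1, <- Ha0, <- (pseries_at_0 b q Hq), <- (pseries_at_0 a p Hp).
    apply Hlt. unfold unit_disk. rewrite Cmod_0. lra. }
  set (u := fun z => (q z - c * p z)%C).
  set (v := fun z => (p z - Cconj c * q z)%C).
  pose proof (pseries_lin_comb b a q p c Hq Hp) as Hu.
  pose proof (pseries_lin_comb a b p q (Cconj c) Hp Hq) as Hv.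
  assert (Hu0 : (b 0%nat - c * a 0%nat)%C = RtoC 0) by (rewrite Ha0; unfold c; ring).
  pose proof (pseries_div_z _ _ Hu Hu0) as Hw. cbv beta in Hw.
  set (w := fun z => if Ceq_dec z 0 then (b 1%nat - c * a 1%nat)%C else (u z / z)%C) in *.
  assert (Hvpos : forall x, unit_disk x -> 0 < Cmod (v x)).
  { intros x Hx. specialize (Hlt x Hx).
    pose proof (Cmod_le_add (p x) (Cconj c * q x)) as Ht. fold (v x) in Ht.
    rewrite Cmod_mult, Cmod_conj in Ht.
    pose proof (Cmod_ge_0 (q x)). pose proof (Cmod_ge_0 c). nra. }
  assert (Huv : forall x, unit_disk x -> Cmod (u x) <= Cmod (v x)).
  { intros x Hx. specialize (Hlt x Hx).
    pose proof (Cmod_disk_automorphism c (p x) (q x)) as E. fold (u x) (v x) in E.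
    pose proof (Cmod_ge_0 (q x)). pose proof (Cmod_ge_0 c).
    assert (0 <= (1 - Cmod c ^ 2) * (Cmod (p x) ^ 2 - Cmod (q x) ^ 2)).
    { apply Rmult_le_pos; simpl; nra. }
    pose proof (Hvpos x Hx). apply Rnot_lt_le. intro Hgt. simpl in *. nra. }
  assert (Hvne : forall x, unit_disk x -> v x <> RtoC 0).
  { intros x Hx. apply Cmod_gt_0, Hvpos, Hx. }
  assert (Hzw : forall x, unit_disk x -> u x = (x * w x)%C).
  { intros x Hx. unfold w. destruct (Ceq_dec x 0) as [->|Hx0].
    - unfold u. rewrite (pseries_at_0 b q Hq), (pseries_at_0 a p Hp), Hu0. ring.
    - field. exact Hx0. }
  assert (Hmax : Cmod (w z / v z) <= 1).
  { revert z Hz. apply (schwarz_lemma_jets (fun x => w x / v x)%C); intros x Hx.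
    - destruct (power_series_has_jet _ _ _ Hw Hx) as (w1 & w2 & Jw & _).
      destruct (power_series_has_jet _ _ _ Hv Hx) as (v1 & v2 & Jv & _).
      destruct (has_jet_div _ _ _ _ _ _ _ _ _ Jw Jv (Hvne x Hx)) as (c2 & J).
      eexists. exists c2. exact J.
    - rewrite <- Cmod_mult.
      replace (x * (w x / v x))%C with (u x / v x)%C
        by (rewrite (Hzw x Hx); field; auto).
      rewrite Cmod_div by auto. apply Rle_div_l; [apply Hvpos, Hx|].
      rewrite Rmult_1_l. apply Huv, Hx. }
  apply disk_automorphism_bound; [exact Hc|split; [apply Cmod_ge_0|exact Hz]|].
  fold (u z) (v z). rewrite (Hzw z Hz), Cmod_mult.
  apply Rmult_le_compat_l; [apply Cmod_ge_0|].
  rewrite Cmod_div in Hmax by auto.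
  apply Rle_div_l in Hmax; [lra|apply Hvpos, Hz].
Qed.

(** * Growth of the derivative *)

Lemma is_pseries_C_derive (a : nat -> C) (h : C -> C) (z : C) :
  power_series_on_disk a h -> unit_disk z ->
  is_Cpseries (derived_coeffs a) z (C_derive h z) /\
  exists c2 : C, has_jet h z (h z) (C_derive h z) c2.
Proof.
  intros Ha Hz. destruct (power_series_has_jet a h z Ha Hz) as (c1 & c2 & J & S).
  rewrite (has_jet_C_derive _ _ _ _ J). split; [exact S|now exists c2].
Qed.

Lemma Rpower_2_pred (x : R) : Rpower 2 x = 2 * Rpower 2 (x - 1).
Proof.
  unfold Rminus. rewrite Rpower_plus, Rpower_Ropp, Rpower_1 by lra. field.
Qed.

(** Neither [m^delta] nor [(m - alpha)/m] decreases with [m], so the ratio of [m] to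
    the weight is largest at [m = 2]. *)
Lemma class_S_weight_bound (alpha delta m : R) :
  0 <= alpha < 1 -> 0 <= delta -> 2 <= m ->
  m <= (1 - alpha) / (Rpower 2 (delta - 1) * (2 - alpha))
       * (Rpower m delta * ((m - alpha) / (1 - alpha))).
Proof.
  intros Ha Hd Hm.
  pose proof (Rpower_2_pred delta) as HP.
  pose proof (exp_pos ((delta - 1) * ln 2)) as Hpos.
  fold (Rpower 2 (delta - 1)) in Hpos.
  pose proof (Rle_Rpower_l 2 m delta Hd) as Hmono.
  set (q := Rpower 2 (delta - 1)) in *. set (t := Rpower m delta) in *.
  assert (Ht : 2 * q <= t) by (rewrite <- HP; apply Hmono; lra).
  replace ((1 - alpha) / (q * (2 - alpha)) * (t * ((m - alpha) / (1 - alpha))))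
    with (t * (m - alpha) / (q * (2 - alpha))) by (field; lra).
  assert (0 < q * (2 - alpha)) by (apply Rmult_lt_0_compat; lra).
  apply Rle_div_r; [assumption|].
  apply Rle_trans with (2 * q * (m - alpha)).
  - assert (0 <= q * (alpha * (m - 2))) by (repeat apply Rmult_le_pos; lra). nra.
  - apply Rmult_le_compat_r; lra.
Qed.

(** All terms of [h'(z) - 1] contain a factor [z], and the other powers of [z] are
    bounded by [1]. *)
Lemma class_S_derivative_bound (alpha delta : R) (h : C -> C) (z : C) :
  0 <= alpha < 1 -> 0 <= delta -> class_S delta alpha h -> unit_disk z ->
  Cmod (C_derive h z)
    <= 1 + (1 - alpha) / (Rpower 2 (delta - 1) * (2 - alpha)) * Cmod z.
Proof.
  intros Hal Hdel (_ & a & Ha & _ & Ha1 & Hu & HS) Hz.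
  set (k := (1 - alpha) / (Rpower 2 (delta - 1) * (2 - alpha))).
  assert (Hk : 0 < k).
  { apply Rdiv_lt_0_compat; [lra|]. apply Rmult_lt_0_compat; [apply exp_pos|lra]. }
  set (u := fun k : nat => Rpower (INR (k + 2)) delta * ((INR (k + 2) - alpha) / (1 - alpha))
      * Cmod (a (k + 2)%nat)) in *.
  destruct (is_pseries_C_derive a h z Ha Hz) as [Hs _].
  assert (Hs1 : is_Cseries (fun n => z ^ (S n) * derived_coeffs a (S n))%C
                  (C_derive h z - 1)%C).
  { apply (is_series_incr_1 (fun n => z ^ n * derived_coeffs a n)%C).
    match goal with |- is_series _ ?l => replace l with (C_derive h z) end.
    - exact Hs.
    - change (C_derive h z = C_derive h z - 1 + 1 * (RtoC 1 * a 1%nat))%C.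
      rewrite Ha1. ring. }
  pose proof (Cmod_ge_0 z) as Hz0. unfold unit_disk in Hz.
  assert (Hle : Cmod (C_derive h z - 1) <= Series (fun n => k * Cmod z * u n)).
  { apply is_Cseries_Cmod_le with (1 := Hs1).
    - intro n. unfold derived_coeffs, u.
      replace (n + 2)%nat with (S (S n)) by lia.
      rewrite (Cmod_mult (z ^ S n)), Cmod_pow, Cmod_mult, Cmod_R, (Rabs_pos_eq (INR _) (pos_INR _)).
      assert (Hm : 2 <= INR (S (S n))).
      { rewrite !S_INR. pose proof (pos_INR n). lra. }
      pose proof (class_S_weight_bound alpha delta _ Hal Hdel Hm) as Hw. fold k in Hw.
      set (W := Rpower (INR (S (S n))) delta * ((INR (S (S n)) - alpha) / (1 - alpha))) in *.
      replace (k * Cmod z * (W * Cmod (a (S (S n)))))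
        with (Cmod z * (k * W * Cmod (a (S (S n))))) by ring.
      apply Rmult_le_compat.
      + now apply pow_le.
      + apply Rmult_le_pos; [apply pos_INR|apply Cmod_ge_0].
      + simpl. apply Rle_trans with (Cmod z * 1); [|lra].
        apply Rmult_le_compat_l; [assumption|].
        rewrite <- (pow1 n). apply pow_incr. lra.
      + apply Rmult_le_compat_r; [apply Cmod_ge_0|exact Hw].
    - now apply (@ex_series_scal R_AbsRing R_NormedModule). }
  rewrite Series_scal_l in Hle.
  pose proof (Cmod_le_add (C_derive h z) 1) as Ht. rewrite Cmod_1 in Ht.
  assert (k * Cmod z * Series u <= k * Cmod z * 1).
  { apply Rmult_le_compat_l; [apply Rmult_le_pos; lra|exact HS]. }
  lra.
Qed.

(** * The extremal problem on the radius *)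

Definition bloch_bound (M A b r : R) : R :=
  (1 + r - r ^ 2 - r ^ 3) * (M + A * r) / (1 + b * r).

Definition bloch_quartic (M A b r : R) : R :=
  M * (1 - b) + A - 2 * (M - A) * r - (M * (3 + b) + A * (3 - b)) * r ^ 2
  - (2 * M * b + A * (4 + 2 * b)) * r ^ 3 - 3 * A * b * r ^ 4.

Definition bloch_cubic (M A b r : R) : R :=
  M * (1 - b) + A - (M * (3 - b) - A) * r
  - (2 * M * b + A * (4 - b)) * r ^ 2 - 3 * A * b * r ^ 3.

(** The root [-1] is that of the double factor [(1 + r)^2] of the numerator of
    [bloch_bound]. *)
Lemma bloch_quartic_factor (M A b r : R) :
  bloch_quartic M A b r = (1 + r) * bloch_cubic M A b r.
Proof. unfold bloch_quartic, bloch_cubic. ring. Qed.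

(** This is where [A <= M] enters: it makes the coefficient of [r] negative. *)
Lemma bloch_cubic_decreasing (M A b r s : R) :
  0 < A <= M -> 0 <= b < 1 -> 0 <= r -> r < s ->
  bloch_cubic M A b s < bloch_cubic M A b r.
Proof.
  intros HA Hb Hr Hrs. unfold bloch_cubic.
  assert ((M * (3 - b) - A) * r < (M * (3 - b) - A) * s) by
    (apply Rmult_lt_compat_l; nra).
  assert ((2 * M * b + A * (4 - b)) * r ^ 2 <= (2 * M * b + A * (4 - b)) * s ^ 2).
  { apply Rmult_le_compat_l; [nra|]. apply pow_incr; lra. }
  assert (3 * A * b * r ^ 3 <= 3 * A * b * s ^ 3).
  { apply Rmult_le_compat_l; [nra|]. apply pow_incr; lra. }
  lra.
Qed.

Lemma is_derive_bloch_bound (M A b r : R) :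
  0 < 1 + b * r ->
  is_derive (bloch_bound M A b) r (bloch_quartic M A b r / (1 + b * r) ^ 2).
Proof.
  intro H. unfold bloch_bound. auto_derive; [lra|].
  unfold bloch_quartic. field. lra.
Qed.

Lemma bloch_quartic_single_crossing (M A b : R) :
  0 < A <= M -> 0 <= b < 1 ->
  exists r0, 0 < r0 < 1 /\ bloch_quartic M A b r0 = 0 /\
    (forall r, 0 <= r < r0 -> 0 < bloch_quartic M A b r) /\
    (forall r, r0 < r -> bloch_quartic M A b r < 0).
Proof.
  intros HA Hb.
  destruct (IVT (fun r => - bloch_cubic M A b r) 0 1) as (r0 & Hr0 & Hz).
  - unfold bloch_cubic. reg.
  - lra.
  - unfold bloch_cubic. nra.
  - unfold bloch_cubic. nra.
  - assert (HK : bloch_cubic M A b r0 = 0) by lra.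
    assert (r0 <> 0) by (intros ->; unfold bloch_cubic in HK; nra).
    assert (r0 <> 1) by (intros ->; unfold bloch_cubic in HK; nra).
    exists r0. split; [lra|]. split; [rewrite bloch_quartic_factor, HK; ring|].
    split; intros r Hr; rewrite bloch_quartic_factor.
    + apply Rmult_lt_0_compat; [lra|].
      rewrite <- HK. apply bloch_cubic_decreasing; lra.
    + assert (bloch_cubic M A b r < 0); [|nra].
      rewrite <- HK. apply bloch_cubic_decreasing; lra.
Qed.

Lemma bloch_bound_max (M A b r0 r : R) :
  0 <= b -> 0 <= r0 -> bloch_quartic M A b r0 = 0 ->
  (forall x, 0 <= x < r0 -> 0 < bloch_quartic M A b x) ->
  (forall x, r0 < x -> bloch_quartic M A b x < 0) ->
  0 <= r -> bloch_bound M A b r <= bloch_bound M A b r0.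
Proof.
  intros Hb Hr0 Hz Hpos Hneg Hr.
  assert (Hden : forall x, 0 <= x -> 0 < 1 + b * x) by (intros; nra).
  assert (Hmin : 0 <= Rmin r r0) by (apply Rmin_glb; lra).
  destruct (MVT_gen (bloch_bound M A b) r r0
              (fun x => bloch_quartic M A b x / (1 + b * x) ^ 2)) as (c & Hc & E).
  - intros x Hx. apply is_derive_bloch_bound, Hden. lra.
  - intros x Hx. apply derivable_continuous_pt.
    eexists. apply is_derive_Reals, is_derive_bloch_bound, Hden. lra.
  - assert (Hc2 : 0 < / (1 + b * c) ^ 2).
    { apply Rinv_0_lt_compat, pow_lt, Hden. lra. }
    assert (0 <= bloch_quartic M A b c * (r0 - r)).
    { destruct (Rle_lt_dec r r0) as [Hle|Hlt].
      - rewrite Rmin_left, Rmax_right in Hc by lra.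
        apply Rmult_le_pos; [|lra].
        destruct (Rle_lt_or_eq_dec _ _ (proj2 Hc)) as [Hc'| ->]; [|lra].
        left. apply Hpos. lra.
      - rewrite Rmin_right, Rmax_left in Hc by lra.
        assert (bloch_quartic M A b c <= 0); [|nra].
        destruct (Rle_lt_or_eq_dec _ _ (proj1 Hc)) as [Hc'| <-]; [|lra].
        left. now apply Hneg. }
    assert (0 <= bloch_quartic M A b c * (r0 - r) * / (1 + b * c) ^ 2)
      by (apply Rmult_le_pos; lra).
    replace (bloch_quartic M A b c / (1 + b * c) ^ 2 * (r0 - r))
      with (bloch_quartic M A b c * (r0 - r) * / (1 + b * c) ^ 2) in E
      by (unfold Rdiv; ring).
    lra.
Qed.

(** * Integration along hyperbolic geodesics *)

Lemma jet_comp_first_order (h gam : C -> C) (t h0 h1 h2 g1 g2 : C) :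
  has_jet h (gam t) h0 h1 h2 -> has_jet gam t (gam t) g1 g2 ->
  exists M d : R, 0 < d /\ forall w : C, Cmod w < d ->
    Cmod (h (gam (t + w)%C) - (h0 + h1 * g1 * w)) <= M * Cmod w ^ 2.
Proof.
  intros Jh Jg.
  destruct (has_jet_first_order _ _ _ _ _ Jh) as (Mh & dh & HMh & Hdh & Hh).
  destruct (has_jet_first_order _ _ _ _ _ Jg) as (Mg & dg & HMg & Hdg & Hg).
  destruct (has_jet_lipschitz _ _ _ _ _ Jg) as (L & dl & HL & Hdl & Hl).
  exists (Mh * L ^ 2 + Cmod h1 * Mg), (Rmin (Rmin dg dl) (dh / (L + 1))).
  split.
  { repeat apply Rmin_glb_lt; try lra. apply Rdiv_lt_0_compat; lra. }
  intros w Hw.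
  pose proof (Rmin_l (Rmin dg dl) (dh / (L + 1))).
  pose proof (Rmin_r (Rmin dg dl) (dh / (L + 1))).
  pose proof (Rmin_l dg dl). pose proof (Rmin_r dg dl).
  assert (Hw3 : Cmod w < dh / (L + 1)) by lra.
  apply (Rmult_lt_compat_r (L + 1)) in Hw3; [|lra].
  replace (dh / (L + 1) * (L + 1)) with dh in Hw3 by (field; lra).
  specialize (Hg w ltac:(lra)). specialize (Hl w ltac:(lra)).
  pose proof (Cmod_ge_0 w).
  set (D := (gam (t + w)%C - gam t)%C) in *.
  specialize (Hh D ltac:(nra)).
  replace (gam t + D)%C with (gam (t + w)%C) in Hh by (unfold D; ring).
  replace (h (gam (t + w)%C) - (h0 + h1 * g1 * w))%C
    with ((h (gam (t + w)%C) - (h0 + h1 * D))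
          + h1 * (gam (t + w)%C - (gam t + g1 * w)))%C by (unfold D; ring).
  eapply Rle_trans; [apply Cmod_triangle|]. rewrite Cmod_mult.
  assert (Cmod D ^ 2 <= (L * Cmod w) ^ 2).
  { apply pow_incr. split; [apply Cmod_ge_0|exact Hl]. }
  assert (Mh * Cmod D ^ 2 <= Mh * (L * Cmod w) ^ 2) by (apply Rmult_le_compat_l; lra).
  assert (Cmod h1 * Cmod (gam (t + w)%C - (gam t + g1 * w))
          <= Cmod h1 * (Mg * Cmod w ^ 2))
    by (apply Rmult_le_compat_l; [apply Cmod_ge_0|exact Hg]).
  replace ((Mh * L ^ 2 + Cmod h1 * Mg) * Cmod w ^ 2)
    with (Mh * (L * Cmod w) ^ 2 + Cmod h1 * (Mg * Cmod w ^ 2)) by ring.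
  lra.
Qed.

(** The image of the ray [s w], [0 <= s <= 1], under the disk automorphism that
    sends [0] to [z].  The parameter [s] is complex so that jets of quotients
    apply. *)
Definition geodesic (z w s : C) : C := ((z + s * w) / (1 + Cconj z * (s * w)))%C.

Lemma affine_has_jet (c0 c1 t : C) :
  has_jet (fun s => c0 + s * c1)%C t (c0 + t * c1)%C c1 0.
Proof.
  exists 0, 1. split; [lra|]. intros w _.
  replace (c0 + (t + w) * c1 - (c0 + t * c1 + c1 * w + 0 * w ^ 2))%C
    with (RtoC 0) by ring.
  rewrite Cmod_0. lra.
Qed.

(** Automorphisms preserve [|dz|/(1 - |z|^2)], and on the ray this density is
    [|w|/(1 - t^2 |w|^2)]. *)
Lemma geodesic_speed (z w : C) (t : R) :
  unit_disk z -> unit_disk w -> 0 <= t <= 1 ->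
  unit_disk (geodesic z w t) /\
  exists g1 g2 : C, has_jet (geodesic z w) t (geodesic z w t) g1 g2 /\
    Cmod g1 * (1 - (t * Cmod w) ^ 2) = Cmod w * (1 - Cmod (geodesic z w t) ^ 2).
Proof.
  unfold unit_disk. intros Hz Hw Ht.
  pose proof (Cmod_ge_0 z). pose proof (Cmod_ge_0 w).
  set (v := (1 + Cconj z * (t * w))%C).
  assert (Htw : Cmod (t * w) = t * Cmod w).
  { rewrite Cmod_mult, Cmod_R, Rabs_pos_eq; lra. }
  assert (Htw1 : 0 <= t * Cmod w < 1) by nra.
  assert (Hv : 0 < Cmod v).
  { pose proof (Cmod_le_add 1 (- (Cconj z * (t * w)))%C) as Hr.
    replace (1 - - (Cconj z * (t * w)))%C with v in Hr by (unfold v; ring).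
    rewrite Cmod_opp, Cmod_mult, Cmod_conj, Htw, Cmod_1 in Hr. nra. }
  assert (Hv0 : v <> RtoC 0) by now apply Cmod_gt_0.
  assert (Hgap : (1 - Cmod (geodesic z w t) ^ 2) * Cmod v ^ 2
                 = (1 - Cmod z ^ 2) * (1 - (t * Cmod w) ^ 2)).
  { unfold geodesic. fold v. rewrite Cmod_div by assumption.
    pose proof (Cmod_disk_automorphism (- z)%C 1 (t * w)%C) as E.
    replace (1 - Cconj (- z) * (t * w))%C with v in E
      by (rewrite Copp_conj; unfold v; ring).
    replace (t * w - - z * 1)%C with (z + t * w)%C in E by ring.
    rewrite Cmod_opp, Cmod_1, Htw in E.
    replace ((1 - (Cmod (z + t * w) / Cmod v) ^ 2) * Cmod v ^ 2)
      with (Cmod v ^ 2 - Cmod (z + t * w) ^ 2) by (field; lra).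
    rewrite E. ring. }
  assert (Hv2 : 0 < Cmod v ^ 2) by now apply pow_lt.
  split.
  - assert (0 < (1 - Cmod z ^ 2) * (1 - (t * Cmod w) ^ 2)).
    { apply Rmult_lt_0_compat; simpl; nra. }
    pose proof (Cmod_ge_0 (geodesic z w t)).
    apply Rnot_le_lt. intro Hge.
    assert (1 <= Cmod (geodesic z w t) ^ 2) by (simpl; nra). nra.
  - pose proof (affine_has_jet z w t) as Ju.
    pose proof (affine_has_jet 1 (Cconj z * w)%C t) as Jv.
    assert (Ev : (1 + t * (Cconj z * w))%C = v) by (unfold v; ring).
    assert (Jgeo : forall f g c0 c1 c2, (forall s, f s = g s) ->
      has_jet f t c0 c1 c2 -> has_jet g t c0 c1 c2).
    { intros f g c0 c1 c2 Hfg (M & d & Hd & HJ). exists M, d. split; [exact Hd|].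
      intros s Hs. rewrite <- Hfg. now apply HJ. }
    rewrite Ev in Jv.
    destruct (has_jet_div _ _ _ _ _ _ _ _ _ Ju Jv Hv0) as (g2 & J).
    eexists. exists g2. split.
    + apply Jgeo with (2 := J). intro s. unfold geodesic. do 2 f_equal. ring.
    + replace ((w - (z + t * w) / v * (Cconj z * w)) / v)%C
        with (w * (1 - Cconj z * z) / v ^ 2)%C by (unfold v in *; field; exact Hv0).
      assert (Ez : (1 - Cconj z * z)%C = RtoC (1 - Cmod z ^ 2)).
      { rewrite RtoC_minus, Cmod2_conj. ring. }
      assert (v ^ 2 <> 0)%C by now apply Cpow_nz.
      rewrite Cmod_div, Cmod_pow, Cmod_mult, Ez, Cmod_R, Rabs_pos_eq
        by (assumption || (simpl; nra)).
      apply Rmult_eq_reg_r with (Cmod v ^ 2); [|lra].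
      rewrite (Rmult_assoc (Cmod w) (1 - Cmod (geodesic z w t) ^ 2)), Hgap. unfold Rdiv. field. lra.
Qed.

Lemma exists_rotation_to_Cmod (D : C) : exists u : C, Cmod u = 1 /\ Re (u * D)%C = Cmod D.
Proof.
  destruct (Ceq_dec D 0) as [->|HD].
  - exists (RtoC 1). rewrite Cmod_1, Cmod_0. split; [reflexivity|].
    simpl. ring.
  - pose proof (proj1 (Cmod_gt_0 D) HD) as Hp.
    assert (Hne : RtoC (Cmod D) <> RtoC 0) by (intro E; apply RtoC_inj in E; lra).
    exists (Cconj D / Cmod D)%C. split.
    + rewrite Cmod_div, Cmod_conj, Cmod_R, Rabs_pos_eq by (assumption || lra).
      field. lra.
    + replace (Cconj D / Cmod D * D)%C with (RtoC (Cmod D)); [apply re_RtoC|].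
      replace (Cconj D / Cmod D * D)%C with (D * Cconj D / Cmod D)%C by (field; assumption).
      rewrite <- Cmod2_conj, RtoC_pow. field. assumption.
Qed.

Lemma is_derive_of_quadratic_error (f : R -> R) (t l M d : R) :
  0 < d -> (forall s, Rabs s < d -> Rabs (f (t + s) - (f t + s * l)) <= M * s ^ 2) ->
  is_derive f t l.
Proof.
  intros Hd H. apply is_derive_Reals. intros eps Heps.
  set (M' := Rmax M 0).
  pose proof (Rmax_l M 0 : M <= M'). pose proof (Rmax_r M 0 : 0 <= M').
  assert (Hp : 0 < Rmin d (eps / (M' + 1))).
  { apply Rmin_glb_lt; [lra|]. apply Rdiv_lt_0_compat; lra. }
  exists (mkposreal _ Hp). simpl. intros s Hs0 Hs.
  assert (Hs1 : Rabs s < d) by (eapply Rlt_le_trans; [apply Hs|apply Rmin_l]).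
  assert (Hs2 : Rabs s < eps / (M' + 1)) by (eapply Rlt_le_trans; [apply Hs|apply Rmin_r]).
  apply (Rmult_lt_compat_r (M' + 1)) in Hs2; [|lra].
  replace (eps / (M' + 1) * (M' + 1)) with eps in Hs2 by (field; lra).
  specialize (H s Hs1). pose proof (Rabs_pos_lt s Hs0) as Hp'.
  replace ((f (t + s) - f t) / s - l) with ((f (t + s) - (f t + s * l)) / s)
    by (field; assumption).
  rewrite Rabs_div by assumption. apply Rlt_div_l; [assumption|].
  eapply Rle_lt_trans; [apply H|].
  rewrite <- (pow2_abs s). simpl. nra.
Qed.

(** Rotate so that [Phi 1 - Phi 0] points in the positive real direction, and
    apply the real mean value theorem to [G - Re (u Phi)], whose derivative is
    nonnegative. *)
Lemma mean_value_inequality (Phi : R -> C) (G dG : R -> R) :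
  (forall t, 0 <= t <= 1 -> is_derive G t (dG t)) ->
  (forall t, 0 <= t <= 1 -> exists (l : C) (M d : R), Cmod l <= dG t /\ 0 < d /\
     forall s : R, Rabs s < d -> Cmod (Phi (t + s)%R - (Phi t + l * s)) <= M * s ^ 2) ->
  Cmod (Phi 1 - Phi 0) <= G 1 - G 0.
Proof.
  intros HG HPhi.
  destruct (exists_rotation_to_Cmod (Phi 1 - Phi 0)) as (u & Hu & HuD).
  set (f := fun t => Re (u * Phi t)%C).
  assert (Hf : forall t, 0 <= t <= 1 -> exists l, l <= dG t /\ is_derive f t l).
  { intros t Ht. destruct (HPhi t Ht) as (l & M & d & Hl & Hd & H).
    exists (Re (u * l)%C). split.
    - eapply Rle_trans; [apply Rle_abs|]. eapply Rle_trans; [apply re_le_Cmod|].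
      rewrite Cmod_mult, Hu. lra.
    - apply is_derive_of_quadratic_error with M d; [exact Hd|]. intros s Hs.
      replace (f (t + s) - (f t + s * Re (u * l)%C))
        with (Re (u * (Phi (t + s)%R - (Phi t + l * s)))%C).
      + eapply Rle_trans; [apply re_le_Cmod|]. rewrite Cmod_mult, Hu, Rmult_1_l.
        now apply H.
      + unfold f. rewrite !re_mult. unfold Cminus.
        rewrite re_plus, im_plus, re_opp, im_opp, re_plus, im_plus, re_scal_r, im_scal_r.
        ring. }
  destruct (MVT_gen (fun t => G t - f t) 0 1 (fun t => dG t - Derive f t)) as (c & Hc & E).
  - rewrite Rmin_left, Rmax_right by lra. intros t Ht.
    destruct (Hf t ltac:(lra)) as (l & _ & Dl).
    apply (@is_derive_minus R_AbsRing R_NormedModule); [apply HG; lra|].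
    apply Derive_correct. now exists l.
  - rewrite Rmin_left, Rmax_right by lra. intros t Ht.
    destruct (Hf t Ht) as (l & _ & Dl).
    apply derivable_continuous_pt. eexists. apply is_derive_Reals.
    apply (@is_derive_minus R_AbsRing R_NormedModule); [apply HG; lra|exact Dl].
  - rewrite Rmin_left, Rmax_right in Hc by lra.
    destruct (Hf c Hc) as (l & Hl & Dl). rewrite (is_derive_unique _ _ _ Dl) in E.
    rewrite <- HuD. replace (Re (u * (Phi 1 - Phi 0))%C) with (f 1 - f 0); [lra|].
    unfold f. rewrite !re_mult. unfold Cminus. rewrite re_plus, im_plus, re_opp, im_opp.
    ring.
Qed.

Lemma arctanh_0 : arctanh 0 = 0.
Proof. unfold arctanh. replace ((1 + 0) / (1 - 0)) with 1 by field. rewrite ln_1. ring. Qed.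

Lemma arctanh_pos (x : R) : 0 < x < 1 -> 0 < arctanh x.
Proof.
  intros Hx. unfold arctanh. apply Rmult_lt_0_compat; [lra|].
  rewrite <- ln_1. apply ln_increasing; [lra|]. apply Rlt_div_r; lra.
Qed.

Lemma is_derive_arctanh_scal (K x t : R) :
  -1 < t * x < 1 ->
  is_derive (fun t => K * arctanh (t * x)) t (K * (x / (1 - (t * x) ^ 2))).
Proof.
  intro H. unfold arctanh. auto_derive.
  - split; [lra|]. split; [apply Rdiv_lt_0_compat; lra|exact I].
  - field. repeat split; try lra. nra.
Qed.

(** Along the geodesic from [z] to [xi] the derivative of [f] is at most
    [(|h'| + |g'|)] times the speed, hence at most [K |w|/(1 - t^2 |w|^2)], which
    is the derivative of [K arctanh (t |w|)]; and [arctanh |w|] is the hyperbolic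
    distance of the end points. *)
Lemma Bloch_quotient_le (f h g : C -> C) (a b : nat -> C) (K : R) (z xi : C) :
  power_series_on_disk a h -> power_series_on_disk b g ->
  (forall z, unit_disk z -> f z = (h z + Cconj (g z))%C) ->
  (forall z, unit_disk z ->
     (1 - Cmod z ^ 2) * (Cmod (C_derive h z) + Cmod (C_derive g z)) <= K) ->
  unit_disk z -> unit_disk xi -> z <> xi ->
  Cmod (f z - f xi) / hyp_dist z xi <= K.
Proof.
  intros Ha Hb Hf HK Hz Hxi Hne.
  set (w := ((xi - z) / (1 - Cconj z * xi))%C).
  assert (Hden : (1 - Cconj z * xi)%C <> RtoC 0).
  { apply Cmod_gt_0. pose proof (Cmod_le_add 1 (Cconj z * xi)%C) as Ht.
    rewrite Cmod_1, Cmod_mult, Cmod_conj in Ht. unfold unit_disk in *.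
    pose proof (Cmod_ge_0 z). pose proof (Cmod_ge_0 xi). nra. }
  assert (Hnum : (xi - z)%C <> RtoC 0).
  { intro E. apply Hne. replace xi with (z + (xi - z))%C by ring. rewrite E. ring. }
  assert (Hdist : hyp_dist z xi = arctanh (Cmod w)).
  { unfold hyp_dist, w. f_equal. rewrite !Cmod_div by assumption.
    now rewrite Cmod_minus_sym. }
  assert (Hw : 0 < Cmod w < 1).
  { pose proof (proj1 (Cmod_gt_0 _) Hden) as Hd. pose proof (proj1 (Cmod_gt_0 _) Hnum) as Hn.
    unfold w. rewrite Cmod_div by assumption. split; [now apply Rdiv_lt_0_compat|].
    apply Rlt_div_l; [exact Hd|]. rewrite Rmult_1_l.
    pose proof (Cmod_disk_automorphism z 1 xi) as E.
    replace (xi - z * 1)%C with (xi - z)%C in E by ring. rewrite Cmod_1 in E.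
    unfold unit_disk in *. pose proof (Cmod_ge_0 z). pose proof (Cmod_ge_0 xi).
    assert (0 < (1 - Cmod z ^ 2) * (1 ^ 2 - Cmod xi ^ 2)) by
      (apply Rmult_lt_0_compat; simpl; nra).
    apply Rnot_le_lt. intro Hge. simpl in *. nra. }
  assert (G0 : geodesic z w 0 = z).
  { unfold geodesic. replace (1 + Cconj z * (0 * w))%C with (RtoC 1) by ring. field. }
  assert (G1 : geodesic z w 1 = xi).
  { unfold geodesic, w.
    assert (H1 : (1 - Cconj z * z)%C <> RtoC 0).
    { replace (1 - Cconj z * z)%C with (RtoC (1 - Cmod z ^ 2)).
      - intro E. apply RtoC_inj in E. unfold unit_disk in Hz.
        pose proof (Cmod_ge_0 z). simpl in E. nra.
      - rewrite RtoC_minus, Cmod2_conj. ring. }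
    field. cbv beta. split; [assumption|].
    replace (1 - Cconj z * xi + Cconj z * (xi - z))%C with (1 - Cconj z * z)%C by ring.
    exact H1. }
  rewrite Hdist. apply Rle_div_l; [now apply arctanh_pos|].
  rewrite Cmod_minus_sym.
  set (gam := geodesic z w) in *.
  pose proof (mean_value_inequality (fun t : R => h (gam t) + Cconj (g (gam t)))%C
    (fun t => K * arctanh (t * Cmod w))
    (fun t => K * (Cmod w / (1 - (t * Cmod w) ^ 2)))) as HMV.
  cbv beta in HMV.
  rewrite G0, G1, Rmult_0_l, Rmult_1_l, arctanh_0, <- !Hf in HMV by assumption.
  apply Rle_trans with (K * arctanh (Cmod w) - K * 0); [|lra].
  apply HMV; intros t Ht; assert (Htw : 0 <= t * Cmod w < 1) by nra.
  - apply is_derive_arctanh_scal. lra.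
  - destruct (geodesic_speed z w t Hz (proj2 Hw) Ht) as (Hin & g1 & g2 & Jg & Hspeed).
    fold gam in Hin, Jg, Hspeed.
    destruct (is_pseries_C_derive a h _ Ha Hin) as (_ & h2 & Jh).
    destruct (is_pseries_C_derive b g _ Hb Hin) as (_ & k2 & Jk).
    destruct (jet_comp_first_order _ _ _ _ _ _ _ _ Jh Jg) as (Mh & dh & Hdh & Hh).
    destruct (jet_comp_first_order _ _ _ _ _ _ _ _ Jk Jg) as (Mk & dk & Hdk & Hk).
    specialize (HK _ Hin).
    set (h1 := C_derive h (gam t)) in *. set (k1 := C_derive g (gam t)) in *.
    exists (h1 * g1 + Cconj (k1 * g1))%C, (Mh + Mk), (Rmin dh dk).
    split; [|split; [apply Rmin_glb_lt; assumption|]].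
    + eapply Rle_trans; [apply Cmod_triangle|].
      rewrite Cmod_conj, !Cmod_mult.
      assert (Hq : 0 < 1 - (t * Cmod w) ^ 2) by (simpl; nra).
      replace (K * (Cmod w / (1 - (t * Cmod w) ^ 2)))
        with (K * Cmod w / (1 - (t * Cmod w) ^ 2)) by (unfold Rdiv; ring).
      apply Rle_div_r; [exact Hq|].
      replace ((Cmod h1 * Cmod g1 + Cmod k1 * Cmod g1) * (1 - (t * Cmod w) ^ 2))
        with (((1 - Cmod (gam t) ^ 2) * (Cmod h1 + Cmod k1)) * Cmod w).
      * apply Rmult_le_compat_r; lra.
      * transitivity ((Cmod h1 + Cmod k1) * (Cmod g1 * (1 - (t * Cmod w) ^ 2)));
          [rewrite Hspeed|]; ring.
    + intros s Hs.
      assert (Hsh : Cmod s < dh) by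
        (rewrite Cmod_R; eapply Rlt_le_trans; [apply Hs|apply Rmin_l]).
      assert (Hsk : Cmod s < dk) by
        (rewrite Cmod_R; eapply Rlt_le_trans; [apply Hs|apply Rmin_r]).
      specialize (Hh s Hsh). specialize (Hk s Hsk).
      rewrite Cmod_R, pow2_abs in Hh, Hk. rewrite RtoC_plus.
      assert (Hsc : Cconj s = s).
      { unfold Cconj, RtoC. simpl. now rewrite Ropp_0. }
      rewrite <- Cmod_conj, Cminus_conj, Cplus_conj, Cmult_conj, Hsc in Hk.
      match goal with |- Cmod ?x <= _ => replace x with
        ((h (gam (t + s)%C) - (h (gam t) + h1 * g1 * s))
         + (Cconj (g (gam (t + s)%C)) - (Cconj (g (gam t)) + Cconj (k1 * g1) * s)))%C
        by ring end.
      eapply Rle_trans; [apply Cmod_triangle|]. lra.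
Qed.

(** * The bound on the Bloch constant *)

(** Schwarz-Pick gives [|h'| + |g'| <= |h'| (1 + b)(1 + r)/(1 + b r)], and
    [(1 - r^2)(1 + r)] is the factor [1 + r - r^2 - r^3] of [bloch_bound]. *)
Lemma bloch_density_le (M A b r x y : R) :
  0 < M -> 0 <= b -> 0 <= r < 1 ->
  x <= 1 + A / M * r -> y * (1 + b * r) <= x * (r + b) ->
  (1 - r ^ 2) * (x + y) <= (1 + b) / M * bloch_bound M A b r.
Proof.
  intros HM Hb Hr Hx Hy.
  assert (Hden : 0 < 1 + b * r) by nra.
  assert (Hr2 : 0 <= 1 - r ^ 2) by (simpl; nra).
  apply Rmult_le_reg_r with (1 + b * r); [exact Hden|].
  replace ((1 + b) / M * bloch_bound M A b r * (1 + b * r))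
    with ((1 - r ^ 2) * ((1 + b) * (1 + r) * (1 + A / M * r)))
    by (unfold bloch_bound; field; lra).
  rewrite Rmult_assoc. apply Rmult_le_compat_l; [exact Hr2|].
  apply Rle_trans with ((1 + b) * (1 + r) * x); [nra|].
  apply Rmult_le_compat_l; [nra|exact Hx].
Qed.

Theorem theorem2p7 (alpha beta delta : R) (f : C -> C)
  (halpha : 0 <= alpha < 1) (hbeta : 0 <= beta < 1) (hdelta : 0 <= delta)
  (hf : class_SH delta alpha beta f) :
  exists r0 : R,
    unique (fun r : R => 0 < r < 1 /\
      Rpower 2 (delta - 1) * (2 - alpha) * (1 - beta) + (1 - alpha)
      - 2 * (Rpower 2 (delta - 1) * (2 - alpha) - (1 - alpha)) * r
      - (Rpower 2 (delta - 1) * (2 - alpha) * (3 + beta)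
         + (1 - alpha) * (3 - beta)) * r ^ 2
      - (Rpower 2 delta * (2 - alpha) * beta
         + (1 - alpha) * (4 + 2 * beta)) * r ^ 3
      - 3 * (1 - alpha) * beta * r ^ 4 = 0) r0 /\
    Rbar_le (Bloch_constant f)
      (Finite ((1 + beta) / ((2 - alpha) * Rpower 2 (delta - 1))
        * (((1 + r0 - r0 ^ 2 - r0 ^ 3)
            * ((2 - alpha) * Rpower 2 (delta - 1) + (1 - alpha) * r0))
           / (1 + beta * r0)))).
Proof.
  destruct hf as (h & g & a & b & (_ & _ & _ & Hg & _ & Hf & Hlt) & HS & Hb1).
  set (A := 1 - alpha). set (M := Rpower 2 (delta - 1) * (2 - alpha)).
  assert (HA : 0 < A <= M).
  { pose proof (Rpower_2_pred delta) as HP.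
    pose proof (Rle_Rpower 2 0 delta ltac:(lra) hdelta) as H1.
    rewrite Rpower_O in H1 by lra. unfold A, M. split; [lra|nra]. }
  destruct (bloch_quartic_single_crossing M A beta HA hbeta)
    as (r0 & Hr0 & Hroot & Hpos & Hneg).
  assert (Heq : forall r, M * (1 - beta) + A - 2 * (M - A) * r
     - (M * (3 + beta) + A * (3 - beta)) * r ^ 2
     - (Rpower 2 delta * (2 - alpha) * beta + A * (4 + 2 * beta)) * r ^ 3
     - 3 * A * beta * r ^ 4 = bloch_quartic M A beta r).
  { intro r. rewrite (Rpower_2_pred delta). unfold bloch_quartic, M. ring. }
  exists r0. split.
  - split.
    + split; [exact Hr0|]. rewrite Heq. exact Hroot.
    + intros r [Hr E]. rewrite Heq in E.
      destruct (Rtotal_order r r0) as [Hl|[<-|Hl]]; [|reflexivity|].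
      * specialize (Hpos r). lra.
      * specialize (Hneg r). lra.
  - replace ((2 - alpha) * Rpower 2 (delta - 1)) with M by (unfold M; ring).
    change (Rbar_le (Bloch_constant f) ((1 + beta) / M * bloch_bound M A beta r0)).
    unfold Bloch_constant. apply Lub_Rbar_correct.
    intros q (z & xi & Hz & Hxi & Hne & ->).
    pose proof HS as (_ & a' & Ha' & _ & Ha1 & _).
    apply (Bloch_quotient_le f h g a' b); try assumption.
    clear z xi Hz Hxi Hne. intros z Hz.
    pose proof (class_S_derivative_bound alpha delta h z halpha hdelta HS Hz) as Hh.
    assert (Hg' : Cmod (C_derive g z) * (1 + beta * Cmod z)
                  <= Cmod (C_derive h z) * (Cmod z + beta)).
    { assert (Hb0 : Cmod (derived_coeffs b 0) = beta).
      { rewrite <- Hb1. unfold derived_coeffs. f_equal. simpl. ring. }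
      rewrite <- Hb0.
      apply schwarz_pick_dilatation with (derived_coeffs a'); try assumption.
      - intros x Hx. now apply is_pseries_C_derive.
      - intros x Hx. now apply is_pseries_C_derive.
      - unfold derived_coeffs. rewrite Ha1. simpl. ring. }
    pose proof (Cmod_ge_0 z) as Hz0. unfold unit_disk in Hz.
    apply Rle_trans with ((1 + beta) / M * bloch_bound M A beta (Cmod z)).
    + apply bloch_density_le; try assumption; lra.
    + apply Rmult_le_compat_l.
      * left. apply Rdiv_lt_0_compat; lra.
      * apply bloch_bound_max; try assumption; lra.
Qed.
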